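(* Assume that: 1. there exist $s>0$ and $C>0$ such that for all $N$, $\mathbb{E}(|Y|^{4+s})<C$ and $\mathbb{E}(|\widetilde Y_N|^{4+s})<C$; 2. $N\,\mathrm{Var}(\delta_N)\to0$ as $N\to\infty$; 3. $\sqrt N\,\mathbb{E}(\delta_N)\to0$ as $N\to\infty$. Then $\{\widetilde T_N^X\}_N$ is asymptotically efficient for estimating $S^X$.
   Context: Let $X\in\mathbb{R}^{p_1}$ and $Z\in\mathbb{R}^{p_2}$ be independent random vectors, $f$ a deterministic (measurable) real-valued function, $Z'$ an independent copy of $Z$, and $Y=f(X,Z)$, $Y^X=f(X,Z')$, with $Y$ square integrable and $\mathrm{Var}(Y)\neq0$. Let $\xi$ be a random variable and $\xi'$ an independent copy of it, with $X,Z,Z',\xi,\xi'$ mutually independent. The Sobol index of the true model is $S^X=\mathrm{Var}(\mathbb{E}(Y|X))/\mathrm{Var}(Y)=\mathrm{Cov}(Y,Y^X)/\mathrm{Var}(Y)$. Metamodel: for each $N$, let $\delta_N=\delta_N(X,Z,\xi)$ and $\delta_N^X=\delta_N(X,Z',\xi')$ be square-integrable perturbations, $\widetilde Y_N=Y+\delta_N$, $\widetilde Y_N^X=Y^X+\delta_N^X$, with $\mathrm{Var}(\widetilde Y_N)\ne0$. Standing assumption: $\delta_N\to c$ in $L^2$ as $N\to\infty$ for some constant $c$. Let $(X_i,Z_i,Z_i',\xi_i,\xi'_i)_{i\ge1}$ be i.i.d. copies of $(X,Z,Z',\xi,\xi')$, and put $Y_i=f(X_i,Z_i)$, $Y_i^X=f(X_i,Z_i')$,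 $\widetilde Y_i=Y_i+\delta_N(X_i,Z_i,\xi_i)$, $\widetilde Y_i^X=Y_i^X+\delta_N(X_i,Z_i',\xi_i')$ (dependence of $\widetilde Y_i,\widetilde Y_i^X$ on $N$ suppressed). With sums over $i=1,\dots,N$, $$\widetilde T^X_N = \frac{ \frac{1}{N} \sum \widetilde Y_i \widetilde Y_i^X - \left(\frac{1}{N} \sum \frac{\widetilde Y_i+\widetilde Y_i^X}{2}\right)^2 }{\frac{1}{N}\sum \frac{\widetilde Y_i^2+ (\widetilde Y_i^X)^2}{2} - \left( \frac{1}{N} \sum \frac{\widetilde Y_i+\widetilde Y_i^X}{2} \right)^2 }$$ (with an arbitrary fixed value when the denominator vanishes). Model: $\mathcal{P}$ is the set of all distributions $Q$ of exchangeable square-integrable random vectors of $\mathbb{R}^2$; the distribution $P$ of $(Y,Y^X)$ belongs to $\mathcal{P}$. The parameter is $\psi(Q)=\mathrm{Cov}_Q(A,B)/\mathrm{Var}_Q(A)$ for $(A,B)\sim Q$ with $\mathrm{Var}_Q(A)\neq0$, so $\psi(P)=S^X$. Asymptotic efficiency (semiparametric sense, van der Vaart, Asymptotic Statistics, Ch. 25): let $\dot{\mathcal{P}}$ be the set of bounded measurable symmetric $g:\mathbb{R}^2\to\mathbb{R}$ (i.e. $g(a,b)=g(b,a)$) with $\mathbb{E}_P(g)=0$, and for $g\in\dot{\mathcal{P}}$ and $|t|$ small let $dP_t^g=(1+tg)\,dP$. The efficient influence function of $\psi$ at $P$ is the element $\widetilde\psi_P$ of the closure of $\dot{\mathcal{P}}$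 in $L^2(P)$ such that $\lim_{t\to0}(\psi(P_t^g)-\psi(P))/t=\mathbb{E}_P(\widetilde\psi_P\, g)$ for all $g\in\dot{\mathcal{P}}$. A sequence $T_N$ is asymptotically efficient at $P$ for estimating $\psi(P)$ if $$\sqrt N\,(T_N-\psi(P))-\frac1{\sqrt N}\sum_{i=1}^N\widetilde\psi_P(Y_i,Y_i^X)\to0\quad\text{in probability as }N\to\infty.$$ (For estimators based on the observations $(Y_i,Y_i^X)$ this is equivalent to being regular with Gaussian limit of variance $\mathbb{E}_P(\widetilde\psi_P^2)$.) *)

(* Defs.v *)
From HB Require Import structures.
From mathcomp Require Import all_boot all_order all_algebra.
From mathcomp Require Import all_classical all_reals all_analysis measurable_realfun.
Set Implicit Arguments.
Unset Strict Implicit.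
Unset Printing Implicit Defensive.
Import Order.TTheory GRing.Theory Num.Theory.
Import numFieldNormedType.Exports.
Local Open Scope classical_set_scope.
Local Open Scope ring_scope.

Section independence.
Context d (T : measurableType d) (R : realType) (P : probability T R).

Definition sigma_of d' (U : measurableType d') (X : T -> U) : set (set T) :=
  preimage_set_system setT X measurable.

(* Mutual independence of a family of set systems: the product rule holds on
   every finite subfamily, and I may be infinite. *)
Definition mutually_independent (I : eqType) (G : I -> set (set T)) : Prop :=
  forall (s : seq I) (A : I -> set T), uniq s ->
    (forall i, i \in s -> G i (A i)) ->
    P (\big[setI/setT]_(i <- s) A i) = (\prod_(i <- s) P (A i))%E.

Definition same_law d' (U : measurableType d') (X X' : T -> U) : Prop :=
  forall A, measurable A -> P (X @^-1` A) = P (X' @^-1` A).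

Definition cvg_in_probability (W : nat -> T -> R) (l : R) : Prop :=
  forall e : R, 0 < e ->
    P [set w | e <= `|W N w - l|] @[N --> \oo] --> 0%E.

End independence.

Section sobol.
Context d (T : measurableType d) (R : realType) (P : probability T R).

Definition is_cond_exp (G : set (set T)) (Y m : T -> R) : Prop :=
  [/\ preimage_set_system setT m measurable `<=` G,
      m \in Lfun P 1%E &
      forall A, G A ->
        (\int[P]_(w in A) (m w)%:E = \int[P]_(w in A) (Y w)%:E)%E].

(* A version of E(Y | X), chosen by epsilon; versions agree almost surely. *)
Definition cond_exp d' (U : measurableType d') (Y : T -> R) (X : T -> U) :
    T -> R :=
  get [set m | is_cond_exp (sigma_of X) Y m].

Definition sobol_index d' (U : measurableType d') (X : T -> U) (Y : T -> R) :
    R :=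
  fine 'V_P[cond_exp Y X] / fine 'V_P[Y].

End sobol.

Section random_vectors.
Context d (T : measurableType d).
Context d1 d2 (U : measurableType d1) (V : measurableType d2).

Definition rv_pair (X : {mfun T >-> U}) (Z : {mfun T >-> V}) : T -> U * V :=
  fun w => (X w, Z w).

Let measurable_rv_pair X Z : measurable_fun setT (rv_pair X Z).
Proof. exact: measurable_fun_pair. Qed.

HB.instance Definition _ X Z :=
  isMeasurableFun.Build _ _ _ _ (rv_pair X Z) (measurable_rv_pair X Z).

End random_vectors.

Section model_output.
Context d (T : measurableType d) (R : realType).
Context d1 d2 d3 (U : measurableType d1) (V : measurableType d2)
  (E : measurableType d3).

Definition output (f : {mfun (U * V)%type >-> R})
    (X : {mfun T >-> U}) (Z : {mfun T >-> V}) : T -> R :=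
  fun w => f (X w, Z w).

Let measurable_output f X Z : measurable_fun setT (output f X Z).
Proof. exact: (measurableT_comp _ (measurable_funPT (rv_pair X Z))). Qed.

HB.instance Definition _ f X Z :=
  isMeasurableFun.Build _ _ _ _ (output f X Z) (measurable_output f X Z).

Definition perturbation (delta : {mfun (U * V * E)%type >-> R})
    (X : {mfun T >-> U}) (Z : {mfun T >-> V}) (xi : {mfun T >-> E}) : T -> R :=
  fun w => delta (X w, Z w, xi w).

Definition meta_output (f : {mfun (U * V)%type >-> R})
    (delta : {mfun (U * V * E)%type >-> R})
    (X : {mfun T >-> U}) (Z : {mfun T >-> V}) (xi : {mfun T >-> E}) : T -> R :=
  output f X Z \+ perturbation delta X Z xi.

Definition joint (X : {mfun T >-> U}) (Z Z' : {mfun T >-> V})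
    (xi xi' : {mfun T >-> E}) : T -> U * V * V * E * E :=
  fun w => (X w, Z w, Z' w, xi w, xi' w).

End model_output.

(* T_N computed from the sample (a_i, b_i), i < N; v0 is the conventional value
   used when the denominator vanishes. *)
Definition sobol_estimator (R : realType) (v0 : R) (N : nat) (a b : nat -> R) :
    R :=
  let mean := N%:R^-1 * \sum_(i < N) (a i + b i) / 2 in
  let num := N%:R^-1 * (\sum_(i < N) a i * b i) - mean ^+ 2 in
  let den := N%:R^-1 * (\sum_(i < N) (a i ^+ 2 + b i ^+ 2) / 2) - mean ^+ 2 in
  if den == 0 then v0 else num / den.

Section tilt.
Context (R : realType).
Variables (Q : probability (R * R)%type R) (g : {mfun (R * R)%type >-> R})
  (t : R).
Local Open Scope ereal_scope.

Definition tilt_density (x : R * R) : R := (Num.max (1 + t * g x) 0)%R.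

Definition tilt_measure (A : set (R * R)) : \bar R :=
  \int[Q]_(x in A) (tilt_density x)%:E.

Let measurable_tilt_density : measurable_fun setT tilt_density.
Proof.
apply: measurable_maxr => //.
by apply: measurable_funD => //; apply: measurable_funM.
Qed.

Let tilt0 : tilt_measure set0 = 0.
Proof. by rewrite /tilt_measure integral_set0. Qed.

Let tilt_ge0 A : 0 <= tilt_measure A.
Proof.
by apply: integral_ge0 => x _; rewrite lee_fin /tilt_density le_max lexx orbT.
Qed.

Let tilt_sigma_additive : semi_sigma_additive tilt_measure.
Proof.
move=> /= F mF tF mUF; rewrite /tilt_measure ge0_integral_bigcup//=.
- apply: is_cvg_ereal_nneg_natsum_cond => n _ _; exact: tilt_ge0.
- exact/measurable_EFinP/measurable_funTS.
- by move=> x _; rewrite lee_fin /tilt_density le_max lexx orbT.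
Qed.

HB.instance Definition _ := isMeasure.Build _ _ _ tilt_measure
  tilt0 tilt_ge0 tilt_sigma_additive.

(* P_t^g, i.e. dP_t = (1 + t g) dP.  Truncating the density at 0 and normalizing
   make it a probability for every t; for g bounded and centered both are
   vacuous as soon as |t| is small (lemma tiltE). *)
Definition tilt : probability (R * R)%type R := mnormalize tilt_measure Q.

Lemma tiltE (M : R) (A : set (R * R)) :
  (forall x, `|g x| <= M)%R -> (`|t| * M < 1)%R -> 'E_Q[g] = 0 ->
  tilt A = \int[Q]_(x in A) (1 + t * g x)%:E.
Proof.
move=> gM tM Eg.
have densE x : tilt_density x = (1 + t * g x)%R.
  apply/max_idPl; rewrite -lerBlDl sub0r lerNl.
  apply: le_trans (ltW tM); rewrite -mulNr.
  apply: le_trans (ler_norm _) _.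
  by rewrite normrM normrN; apply: ler_wpM2l.
have tiltmE B : tilt_measure B = \int[Q]_(x in B) (1 + t * g x)%:E.
  by apply: eq_integral => x _; rewrite densE.
have ig : Q.-integrable setT (EFin \o g).
  apply: (@le_integrable _ _ _ Q _ measurableT _ (cst M%:E)).
  - exact/measurable_EFinP.
  - by move=> x _ /=; rewrite lee_fin (le_trans (gM x))// ler_norm.
  - exact: finite_measure_integrable_cst.
have mass1 : tilt_measure setT = 1.
  rewrite tiltmE; under eq_integral do rewrite EFinD EFinM.
  rewrite integralD//; last 2 first.
  - exact: finite_measure_integrable_cst.
  - exact: integrableZl.
  rewrite integral_cst// [X in _ * X](@probability_setT _ _ _ Q) mule1 integralZl//.
  by move: Eg; rewrite unlock => ->; rewrite mule0 adde0.
rewrite -tiltmE.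
transitivity (mnormalize tilt_measure Q A) => //.
rewrite /mnormalize [X in _ || (X == _)]mass1 [X in X == 0]mass1 onee_eq0/=.
by rewrite [X in fine X]mass1 invr1 mule1.
Qed.

End tilt.

Section efficiency.
Context (R : realType).
Implicit Type Q : probability (R * R)%type R.

Definition exchangeable_model : set (probability (R * R)%type R) :=
  [set Q | [/\ (fst : R * R -> R) \in Lfun Q 2%:E,
               (snd : R * R -> R) \in Lfun Q 2%:E &
               forall A, measurable A -> Q ((fun x => (x.2, x.1)) @^-1` A) = Q A]].

Definition psi Q : R :=
  fine (covariance Q fst snd) / fine 'V_Q[fst].

Definition tangent_set Q : set {mfun (R * R)%type >-> R} :=
  [set g | [/\ exists M : R, forall x, `|g x| <= M,
               forall a b, g (a, b) = g (b, a) &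
               ('E_Q[g] = 0)%E]].

Definition in_L2_closure Q (D : set {mfun (R * R)%type >-> R})
    (h : {mfun (R * R)%type >-> R}) : Prop :=
  (h : R * R -> R) \in Lfun Q 2%:E /\
  forall e : R, 0 < e -> exists2 g, D g &
    ('N[Q]_2%:E[EFin \o (h \- g)%R] < e%:E)%E.

(* This determines h up to Q-almost everywhere equality. *)
Definition is_efficient_influence_function Q
    (h : {mfun (R * R)%type >-> R}) : Prop :=
  in_L2_closure Q (tangent_set Q) h /\
  forall g, tangent_set Q g ->
    (psi (tilt Q g t) - psi Q) / t @[t --> 0^'] --> fine ('E_Q[(h \* g)%R])%E.

Definition asymptotically_efficient d (T : measurableType d)
    (P : probability T R) (obs : nat -> T -> R * R) (TN : nat -> T -> R) Q :
    Prop :=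
  exchangeable_model Q /\
  exists2 h, is_efficient_influence_function Q h &
    cvg_in_probability P (fun N w =>
      Num.sqrt N%:R * (TN N w - psi Q)
      - (Num.sqrt N%:R)^-1 * \sum_(i < N) h (obs i w)) 0.

End efficiency.

(* Main.v *)
Require Import Defs.
From HB Require Import structures.
From mathcomp Require Import all_boot all_order all_algebra.
From mathcomp Require Import all_classical all_reals all_analysis measurable_realfun.
From mathcomp Require Import ring lra.
Set Implicit Arguments.
Unset Strict Implicit.
Unset Printing Implicit Defensive.
Import Order.TTheory GRing.Theory Num.Theory.
Import numFieldNormedType.Exports.
Local Open Scope classical_set_scope.
Local Open Scope ring_scope.

(** The estimator is a smooth function of three empirical means, so the statement
    is the delta method, and the point is that the perturbations are too small to
    be seen at the scale [1 / sqrt N].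

    The assumptions on the variance and on the mean of the perturbations combine
    into one fact: since
    [N E(delta_N ^ 2) = N Var(delta_N) + (sqrt N E(delta_N)) ^ 2], this product
    tends to 0 ([scaled_second_moment_cvg0]).  As an average of [N] products of a
    fixed square integrable output and a perturbation has an L1 norm at most
    [C (E(delta_N ^ 2)) ^ (1 / 2) = o(1 / sqrt N)], replacing the outputs by those
    of the metamodel changes the numerator and the denominator of the estimator
    by [o(1 / sqrt N)] in L1.  The perturbation [delta_N(X, Z', xi')] has the same
    law as [delta_N(X, Z, xi)], so both are covered.

    Write [S] for the index, [v] for the variance of the output, [U] and [D] for
    the numerator and the denominator of the estimator.  Both are invariant under
    translation, so the outputs may be centred, and
    [U - S D] is then the average of the centred variable
    [zeta = Y Y' - S (Y ^ 2 + Y' ^ 2) / 2] up to [o(1 / sqrt N)]; the squared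
    empirical mean is of order [1 / N].  Hence
    [sqrt N (U / D - S) = sqrt N (U - S D) / D] is close to the normalised sum of
    [zeta / v] as soon as [D] tends to [v] in probability, because that normalised
    sum is bounded in L2 ([sobol_estimator_linear]).  Only Markov's inequality and
    the variance of a sum of independent variables are used; the fourth moment of
    the output makes [zeta] and [Y ^ 2] square integrable.

    It remains to recognise [zeta / v] as the efficient influence function
    ([sobol_influence_efficient]).  Along the path [(1 + t g) dQ] all moments are
    affine in [t], so the parameter is a rational function of [t] whose derivative
    at 0 is the expectation of [g zeta / v]; and [zeta / v] is a symmetric, centred
    and square integrable function, hence an L2 limit of recentred truncations,
    which belong to the tangent set.

    Finally the parameter at the law of the pair of outputs is the Sobol index
    ([covariance_pick_freeze]): given [X] the two outputs are independent with the
    same mean [E(Y | X)], and that law is exchangeable because [(X, Z, Z')] and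
    [(X, Z', Z)] have the same law. *)

(** * Convergence to 0 in probability *)

Section convergence_in_probability.
Context d (T : measurableType d) (R : realType) (P : probability T R).
Implicit Types W U V : nat -> T -> R.

Lemma nonneg_cvge0P (u : nat -> \bar R) : (forall n, 0 <= u n)%E ->
  (u n @[n --> \oo] --> 0%E) <->
  (forall e : R, 0 < e -> \forall n \near \oo, (u n <= e%:E)%E).
Proof.
move=> u0; split=> [cu e e0|H].
  move/fine_cvgP: cu => -[ufin /cvgrPdist_le/(_ _ e0) ue]; near=> n.
  have un : u n \is a fin_num by near: n; exact: ufin.
  have : `|0 - fine (u n)| <= e by near: n; exact: ue.
  by rewrite sub0r normrN ger0_norm ?fine_ge0// -(fineK un) lee_fin.
apply/fine_cvgP; split.
  near=> n; rewrite ge0_fin_numE//.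
  by apply: (@le_lt_trans _ _ 1%:E); [near: n; exact: H|rewrite ltry].
apply/cvgrPdist_le => /= e e0; near=> n.
have une : (u n <= e%:E)%E by near: n; exact: H.
rewrite sub0r normrN ger0_norm ?fine_ge0//.
by rewrite -lee_fin fineK// ge0_fin_numE// (le_lt_trans une)// ltry.
Unshelve. all: by end_near. Qed.

Lemma measurable_ge_norm (e : R) (F : T -> R) : measurable_fun setT F ->
  measurable [set w | e <= `|F w|].
Proof.
move=> mF; rewrite -[X in measurable X]setTI.
have := measurable_fun_ler (@measurable_cst _ _ T _ setT e)
  (measurableT_comp (@normr_measurable R setT) mF).
by move/(_ measurableT [set true]); apply.
Qed.

Lemma cvg_proba0P W : cvg_in_probability P W 0 <->
  forall e : R, 0 < e -> forall eps : R, 0 < eps ->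
    \forall N \near \oo, (P [set w | (e <= `|W N w|)%R] <= eps%:E)%E.
Proof.
have E (e : R) : (fun N => P [set w | e <= `|W N w - 0|]) =
    (fun N => P [set w | e <= `|W N w|]).
  by apply/funext => N; under eq_set do rewrite subr0.
split=> H e e0; last by rewrite E; apply/nonneg_cvge0P => // eps eps0; exact: H.
by move=> eps eps0; move: (H e e0); rewrite E => /nonneg_cvge0P; apply.
Qed.

Lemma eq_cvg_proba W V : (forall N w, W N w = V N w) ->
  cvg_in_probability P W 0 -> cvg_in_probability P V 0.
Proof. by move=> WV; rewrite (_ : W = V)//; do 2 apply/funext => ?. Qed.

Lemma markov_norm (F : T -> R) (e : R) : P.-integrable setT (EFin \o F) ->
  0 < e -> (P [set w | (e <= `|F w|)%R] <= (e^-1 * \int[P]_w `|F w|)%R%:E)%E.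
Proof.
move=> iF e0.
have mF : measurable_fun setT (EFin \o F) by exact: measurable_int iF.
have := le_integral_abse P measurableT mF e0.
rewrite setTI/= => H.
rewrite EFinM -lee_pdivrMl ?invr_gt0// invrK.
rewrite /Rintegral fineK//.
apply: integrable_fin_num => //; exact: integrable_norm.
Qed.

Lemma cvg_proba_L1 W :
  (forall N, (0 < N)%N -> P.-integrable setT (EFin \o W N)) ->
  (\int[P]_w `|W N w|) @[N --> \oo] --> (0 : R) ->
  cvg_in_probability P W 0.
Proof.
move=> iW W0; apply/cvg_proba0P => e e0 eps eps0.
have h : 0 < e * eps by exact: mulr_gt0.
move/cvgrPdist_le : W0 => /(_ _ h) W0.
near=> N.
apply: le_trans (markov_norm (iW N _) e0) _.
  by near: N; exact: nbhs_infty_gt.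
rewrite lee_fin ler_pdivrMl//.
have : `|0 - \int[P]_w `|W N w| | <= e * eps by near: N; exact: W0.
by rewrite sub0r normrN; apply: le_trans; rewrite ler_norm.
Unshelve. all: by end_near. Qed.

(** The common source of the closure properties below: if a deviation of [W]
    forces a deviation of [U] or of [V] of a size that does not depend on [N],
    the union bound transfers convergence from [U] and [V] to [W]. *)
Lemma cvg_proba_cover W U V :
  (forall N, (0 < N)%N -> measurable_fun setT (W N)) ->
  (forall N, (0 < N)%N -> measurable_fun setT (U N)) ->
  (forall N, (0 < N)%N -> measurable_fun setT (V N)) ->
  (forall e : R, 0 < e -> exists a b : R, [/\ 0 < a, 0 < b &
    forall N w, (0 < N)%N -> e <= `|W N w| -> a <= `|U N w| \/ b <= `|V N w|]) ->
  cvg_in_probability P U 0 -> cvg_in_probability P V 0 ->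
  cvg_in_probability P W 0.
Proof.
move=> mW mU mV H /cvg_proba0P cU /cvg_proba0P cV; apply/cvg_proba0P => e e0 eps eps0.
have [a [b [a0 b0 Hab]]] := H e e0.
have eps20 : 0 < eps / 2 by rewrite divr_gt0.
near=> N.
have N0 : (0 < N)%N by near: N; exact: nbhs_infty_gt.
have mUN := measurable_ge_norm a (mU N N0).
have mVN := measurable_ge_norm b (mV N N0).
apply: (@le_trans _ _ (P ([set w | a <= `|U N w|] `|` [set w | b <= `|V N w|]))).
  apply: le_measure; rewrite ?inE; last by move=> w /= ?; exact: Hab.
  - exact: measurable_ge_norm (mW N N0).
  - exact: measurableU.
apply: (le_trans (measureU2 _ mUN mVN)).
rewrite (splitr eps) EFinD leeD//; near: N; [exact: cU|exact: cV].
Unshelve. all: by end_near. Qed.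

Lemma cvg_proba_le W U :
  (forall N, (0 < N)%N -> measurable_fun setT (W N)) ->
  (forall N, (0 < N)%N -> measurable_fun setT (U N)) ->
  (forall N w, (0 < N)%N -> `|W N w| <= `|U N w|) ->
  cvg_in_probability P U 0 -> cvg_in_probability P W 0.
Proof.
move=> mW mU WU cU; apply: (cvg_proba_cover mW mU mU) => // e e0.
by exists e, e; split=> // N w N0 /le_trans h; left; exact/h/WU.
Qed.

Lemma cvg_probaD U V :
  (forall N, (0 < N)%N -> measurable_fun setT (U N)) ->
  (forall N, (0 < N)%N -> measurable_fun setT (V N)) ->
  cvg_in_probability P U 0 -> cvg_in_probability P V 0 ->
  cvg_in_probability P (fun N => U N \+ V N) 0.
Proof.
move=> mU mV; apply: cvg_proba_cover => // [N N0|e e0].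
  by apply: measurable_funD; [exact: mU|exact: mV].
exists (e / 2), (e / 2); split; rewrite ?divr_gt0// => N w _ /= h.
have [?|Ua] := leP (e / 2) `|U N w|; first by left.
right; rewrite leNgt; apply/negP => Va.
have := le_lt_trans (ler_normD _ _) (ltrD Ua Va).
by rewrite -splitr ltNge h.
Qed.

Lemma cvg_proba_scale (k : R) U :
  (forall N, (0 < N)%N -> measurable_fun setT (U N)) ->
  cvg_in_probability P U 0 ->
  cvg_in_probability P (fun N w => k * U N w) 0.
Proof.
move=> mU cU; apply: (cvg_proba_cover _ mU mU) => // [N N0|e e0].
  by apply: measurable_funM => //; exact: mU.
exists (e / (`|k| + 1)), (e / (`|k| + 1)).
have k1 : 0 < `|k| + 1 by rewrite ltr_wpDl.
split; rewrite ?divr_gt0// => N w _ h; left.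
rewrite ler_pdivrMr// (le_trans h)// normrM mulrC ler_wpM2l//.
by rewrite lerDl.
Qed.

(** A sequence bounded in L2 is bounded in probability, by Markov's inequality
    for its square, so that a factor tending to 0 in probability wins.  This
    boundedness replaces a central limit theorem throughout. *)
Lemma cvg_proba_mul_bounded U V (K : R) :
  (forall N, (0 < N)%N -> measurable_fun setT (U N)) ->
  (forall N, (0 < N)%N -> measurable_fun setT (V N)) ->
  (forall N, (0 < N)%N -> P.-integrable setT (EFin \o (fun w => U N w ^+ 2))) ->
  (forall N, (0 < N)%N -> \int[P]_w (U N w ^+ 2) <= K) ->
  cvg_in_probability P V 0 -> cvg_in_probability P (fun N => U N \* V N) 0.
Proof.
move=> mU mV iU UK /cvg_proba0P cV; apply/cvg_proba0P => e e0 eps eps0.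
have eps20 : 0 < eps / 2 by rewrite divr_gt0.
(* M makes K / M at most eps / 2, and M >= 1 gives M <= M ^ 2. *)
pose M : R := Num.max 1 (K * (eps / 2)^-1).
have M1 : 1 <= M by rewrite /M le_max lexx.
have M0 : 0 < M by exact: lt_le_trans M1.
have eM0 : 0 < e / M by rewrite divr_gt0.
near=> N.
have N0 : (0 < N)%N by near: N; exact: nbhs_infty_gt.
have mU2 := measurable_ge_norm M (measurable_funX 2 (mU N N0)).
have mUN := measurable_ge_norm M (mU N N0).
have mVN := measurable_ge_norm (e / M) (mV N N0).
have -> : eps = eps / 2 + eps / 2 by rewrite -splitr.
apply: (@le_trans _ _ (P ([set w | M <= `|U N w|] `|` [set w | e / M <= `|V N w|]))).
  apply: le_measure; rewrite ?inE.
  - apply: measurable_ge_norm; apply: measurable_funM; [exact: mU|exact: mV].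
  - exact: measurableU.
  - move=> w /= h; have [?|Ua] := leP M `|U N w|; first by left.
    right; rewrite ler_pdivrMr// (le_trans h)// normrM mulrC.
    by rewrite ler_wpM2l// ltW.
apply: (le_trans (measureU2 _ mUN mVN)).
rewrite EFinD leeD//; last by near: N; exact: cV.
apply: (@le_trans _ _ (P [set w | M <= `|U N w ^+ 2|])).
  apply: le_measure; rewrite ?inE//.
  move=> w /= h; rewrite normrX expr2 (le_trans h)// ler_peMl//.
  exact: le_trans M1 h.
apply: le_trans (markov_norm (iU N N0) M0) _.
rewrite lee_fin ler_pdivrMl//.
have -> : \int[P]_w `|U N w ^+ 2| = \int[P]_w (U N w ^+ 2).
  by apply: eq_Rintegral => w _; rewrite ger0_norm ?sqr_ge0.
apply: (le_trans (UK N N0)).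
by rewrite -ler_pdivrMr// /M le_max lexx orbT.
Unshelve. all: by end_near. Qed.

End convergence_in_probability.

(** * Laws, independence and sums of independent copies *)

Lemma integrable_sqr_Lfun2 d (T : measurableType d) (R : realType)
    (mu : {measure set T -> \bar R}) (F : T -> R) : measurable_fun setT F ->
  mu.-integrable setT (EFin \o (fun w => F w ^+ 2)) -> F \in Lfun mu 2%:E.
Proof.
move=> mF /integrableP[_ iF]; rewrite inE/=; apply/andP; split; rewrite inE//=.
rewrite /finite_norm unlock poweR_lty//.
apply: le_lt_trans iF; apply: ge0_le_integral => //=.
- apply/measurable_EFinP; apply: (measurableT_comp (measurable_powR 2)).
  exact: measurableT_comp.
- by apply/measurable_EFinP; apply: measurableT_comp => //; exact: measurable_funX.
- by move=> w _; rewrite lee_fin powR_mulrn// normrX.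
Qed.

Section laws.
Context d (T : measurableType d) (R : realType) (P : probability T R).

Lemma same_law_integral d' (U : measurableType d') (X X' : {mfun T >-> U})
    (F : U -> \bar R) : same_law P X X' -> measurable_fun setT F ->
  (\int[P]_w F (X w) = \int[P]_w F (X' w))%E.
Proof.
move=> XX' mF.
have ge0 (G : U -> \bar R) : measurable_fun setT G -> (forall x, 0 <= G x)%E ->
    (\int[P]_w G (X w) = \int[P]_w G (X' w))%E.
  move=> mG G0.
  rewrite -[LHS](ge0_integral_distribution X)// -[RHS](ge0_integral_distribution X')//.
  by apply: eq_measure_integral => A mA _; exact: XX'.
rewrite integralE [RHS]integralE.
rewrite (funepos_comp F X) (funepos_comp F X').
rewrite (funeneg_comp F X) (funeneg_comp F X').
have pos := ge0 _ (measurable_funepos mF) (funepos_ge0 F).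
have neg := ge0 _ (measurable_funeneg mF) (funeneg_ge0 F).
by rewrite [X in (X - _)%E]pos [X in (_ - X)%E]neg.
Qed.

Lemma same_law_Rintegral d' (U : measurableType d') (X X' : {mfun T >-> U})
    (F : U -> R) : same_law P X X' -> measurable_fun setT F ->
  \int[P]_w F (X w) = \int[P]_w F (X' w).
Proof.
move=> XX' mF; congr fine.
by apply: (@same_law_integral _ _ X X' (EFin \o F)) => //; exact/measurable_EFinP.
Qed.

Lemma same_law_integrable d' (U : measurableType d') (X X' : {mfun T >-> U})
    (F : U -> R) : same_law P X X' -> measurable_fun setT F ->
  P.-integrable setT (EFin \o (F \o X')) -> P.-integrable setT (EFin \o (F \o X)).
Proof.
move=> XX' mF /integrableP[_ F'oo]; apply/integrableP; split.
  by apply/measurable_EFinP; exact: measurableT_comp.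
rewrite [ltLHS](same_law_integral (F := fun x => `|(F x)%:E|%E) XX')//.
by apply: measurableT_comp => //; exact/measurable_EFinP.
Qed.

Lemma mutually_independent2 (I : eqType) (G : I -> set (set T)) i j A B :
  mutually_independent P G -> i != j -> G i A -> G j B ->
  P (A `&` B) = (P A * P B)%E.
Proof.
move=> H ij GA GB.
have := H [:: i; j] (fun k => if k == i then A else B).
rewrite !big_cons !big_nil/= eqxx eq_sym (negbTE ij) setIT mule1; apply.
  by rewrite inE ij.
by move=> k; rewrite !inE => /orP[]/eqP->; rewrite ?eqxx// eq_sym (negbTE ij).
Qed.

Lemma mutually_independent3 (I : eqType) (G : I -> set (set T)) i j k A B C :
  mutually_independent P G -> uniq [:: i; j; k] -> G i A -> G j B -> G k C ->
  P (A `&` B `&` C) = (P A * P B * P C)%E.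
Proof.
move=> H uijk GA GB GC.
have /and3P[] := uijk; rewrite !inE negb_or => /andP[ij ik] jk _.
have := H [:: i; j; k] (fun l => if l == i then A else if l == j then B else C).
rewrite !big_cons !big_nil/= !eqxx [j == i]eq_sym (negbTE ij).
rewrite [k == i]eq_sym (negbTE ik) [k == j]eq_sym (negbTE jk) setIT mule1.
rewrite setIA muleA; apply => // l.
rewrite !inE => /or3P[]/eqP->; rewrite ?eqxx//.
- by rewrite eq_sym (negbTE ij).
- by rewrite eq_sym (negbTE ik) eq_sym (negbTE jk).
Qed.

Lemma mutually_independent3_preimage (I : eqType) (G : I -> set (set T))
    i j k d1 d2 d3 (U : measurableType d1) (V : measurableType d2)
    (W : measurableType d3) (X : {mfun T >-> U}) (Y : {mfun T >-> V})
    (Z : {mfun T >-> W}) :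
  mutually_independent P G -> uniq [:: i; j; k] ->
  sigma_of X `<=` G i -> sigma_of Y `<=` G j -> sigma_of Z `<=` G k ->
  forall A B C, measurable A -> measurable B -> measurable C ->
  P (X @^-1` A `&` Y @^-1` B `&` Z @^-1` C) =
  (P (X @^-1` A) * P (Y @^-1` B) * P (Z @^-1` C))%E.
Proof.
move=> H uijk GX GY GZ A B C mA mB mC.
apply: (mutually_independent3 H uijk).
- by apply: GX; exists A => //; rewrite setTI.
- by apply: GY; exists B => //; rewrite setTI.
- by apply: GZ; exists C => //; rewrite setTI.
Qed.

End laws.

Section product_law.
Context d1 d2 d3 (U : measurableType d1) (V : measurableType d2)
  (W : measurableType d3) (R : realType).

(** For a fixed measurable [C] both sides are finite measures in the first two
    coordinates that agree on the pi-system of rectangles; once they agree on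
    all [E `*` C], uniqueness of the product measure concludes. *)
Lemma product_measure3_unique (m1 : probability U R) (m2 : probability V R)
    (m12 : probability (U * V)%type R) (m3 : probability W R)
    (m : probability (U * V * W)%type R) :
  (forall A B, measurable A -> measurable B -> m12 (A `*` B) = (m1 A * m2 B)%E) ->
  (forall A B C, measurable A -> measurable B -> measurable C ->
    m ((A `*` B) `*` C) = (m1 A * m2 B * m3 C)%E) ->
  forall D, measurable D -> (m12 \x m3)%E D = m D.
Proof.
move=> m12E mE D mD.
apply: (product_measure_unique (m1 := m12) (m2 := m3) (m' := m)) => //.
move=> E C mAB mC {D mD}.
have mTC : measurable ([set: U * V] `*` C) by exact: measurableX.
have r0 : 0 <= fine (m3 C) by rewrite fine_ge0.
pose slice : measure (U * V)%type R := pushforward (mrestr m mTC) fst.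
pose mu1 : measure (U * V)%type R := slice measurable_fst.
pose mu2 : measure (U * V)%type R := mscale (NngNum r0) m12.
have mu1E X : mu1 X = m (X `*` C).
  rewrite /mu1 /slice/= /pushforward /mrestr; congr (m _).
  by apply/seteqP; split=> -[x y] /=; [move=> [? []]|move=> []].
have mu2E X : mu2 X = (m12 X * m3 C)%E.
  by rewrite /mu2/= /mscale/= fineK ?fin_num_measure// muleC.
transitivity (mu1 E); first by rewrite mu1E.
transitivity (mu2 E); last by rewrite mu2E.
apply: (measure_unique [set A `*` B | A in measurable & B in measurable]
  (fun=> setT)) => //.
- exact: measurable_prod_measurableType.
- move=> _ _ [A mA [B mB <-]] [A' mA' [B' mB' <-]].
  rewrite -setXI; exists (A `&` A'); first exact: measurableI.
  by exists (B `&` B') => //; exact: measurableI.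
- by move=> _; exists setT => //; exists setT => //; rewrite setXTT.
- by rewrite bigcup_const.
- move=> _ [A mA [B mB <-]]; by rewrite mu1E mu2E mE// m12E.
- by move=> _; rewrite mu1E (le_lt_trans (probability_le1 _ _)) ?ltry//;
    exact: measurableX.
Qed.

End product_law.

Section independence.
Context d (T : measurableType d) (R : realType) (P : probability T R).

Lemma independent_pair_law d1 d2 (U : measurableType d1) (V : measurableType d2)
    (X : {mfun T >-> U}) (Y : {mfun T >-> V}) :
  (forall A B, measurable A -> measurable B ->
    P (X @^-1` A `&` Y @^-1` B) = (P (X @^-1` A) * P (Y @^-1` B))%E) ->
  forall D, measurable D ->
    distribution P (rv_pair X Y) D = (distribution P X \x distribution P Y)%E D.
Proof.
move=> XY D mD; apply/esym.
by apply: (product_measure_unique (m' := distribution P (rv_pair X Y))).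
Qed.

Lemma independent_triple_law d1 d2 d3 (U : measurableType d1)
    (V : measurableType d2) (W : measurableType d3)
    (X : {mfun T >-> U}) (Y : {mfun T >-> V}) (Z : {mfun T >-> W}) :
  (forall A B C, measurable A -> measurable B -> measurable C ->
    P (X @^-1` A `&` Y @^-1` B `&` Z @^-1` C) =
    (P (X @^-1` A) * P (Y @^-1` B) * P (Z @^-1` C))%E) ->
  forall D, measurable D ->
    distribution P (rv_pair (rv_pair X Y) Z) D =
    (distribution P (rv_pair X Y) \x distribution P Z)%E D.
Proof.
move=> XYZ D mD; apply/esym.
apply: (product_measure3_unique (m1 := distribution P X)
  (m2 := distribution P Y) (m12 := distribution P (rv_pair X Y))
  (m := distribution P (rv_pair (rv_pair X Y) Z))) => // A B mA mB.
have := XYZ A B setT mA mB measurableT.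
by rewrite preimage_setT setIT probability_setT mule1.
Qed.

(** Both laws are determined by the marginals.  This is what makes the two
    copies of the model exchangeable, and gives both perturbations of one sample
    point the same law. *)
Lemma independent_triple_same_law d1 d2 d3 (U : measurableType d1)
    (V : measurableType d2) (W : measurableType d3)
    (X X' : {mfun T >-> U}) (Y Y' : {mfun T >-> V}) (Z Z' : {mfun T >-> W}) :
  (forall A B C, measurable A -> measurable B -> measurable C ->
    P (X @^-1` A `&` Y @^-1` B `&` Z @^-1` C) =
    (P (X @^-1` A) * P (Y @^-1` B) * P (Z @^-1` C))%E) ->
  (forall A B C, measurable A -> measurable B -> measurable C ->
    P (X' @^-1` A `&` Y' @^-1` B `&` Z' @^-1` C) =
    (P (X' @^-1` A) * P (Y' @^-1` B) * P (Z' @^-1` C))%E) ->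
  same_law P X X' -> same_law P Y Y' -> same_law P Z Z' ->
  same_law P (rv_pair (rv_pair X Y) Z) (rv_pair (rv_pair X' Y') Z').
Proof.
move=> h h' XX' YY' ZZ' D mD.
transitivity ((distribution P (rv_pair X Y) \x distribution P Z)%E D).
  exact: (independent_triple_law h mD).
apply: (product_measure3_unique (m1 := distribution P X)
  (m2 := distribution P Y) (m12 := distribution P (rv_pair X Y))
  (m := distribution P (rv_pair (rv_pair X' Y') Z'))) => // [A B mA mB|A B C mA mB mC].
  have := h A B setT mA mB measurableT.
  by rewrite preimage_setT setIT probability_setT mule1.
rewrite [LHS]h'//; congr (_ * _ * _)%E; apply/esym;
  [exact: XX'|exact: YY'|exact: ZZ'].
Qed.

Lemma independent_integralM d1 d2 (U : measurableType d1)
    (V : measurableType d2) (X : {mfun T >-> U}) (Y : {mfun T >-> V})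
    (F : U -> R) (G : V -> R) :
  (forall A B, measurable A -> measurable B ->
    P (X @^-1` A `&` Y @^-1` B) = (P (X @^-1` A) * P (Y @^-1` B))%E) ->
  measurable_fun setT F -> measurable_fun setT G ->
  P.-integrable setT (EFin \o (F \o X)) ->
  P.-integrable setT (EFin \o (G \o Y)) ->
  P.-integrable setT (EFin \o (fun w => F (X w) * G (Y w))) ->
  \int[P]_w (F (X w) * G (Y w)) = \int[P]_w F (X w) * \int[P]_w G (Y w).
Proof.
move=> XY mF mG iF iG iFG.
pose m1 : probability U R := distribution P X.
pose m2 : probability V R := distribution P Y.
pose H : U * V -> \bar R := fun z => (F z.1 * G z.2)%:E.
have mH : measurable_fun setT H.
  by apply/measurable_EFinP; apply: measurable_funM; exact: measurableT_comp.
have lawE : forall D, measurable D ->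
  distribution P (rv_pair X Y) D = (m1 \x m2)%E D by exact: independent_pair_law.
have iH : ((m1 \x m2)%E).-integrable setT H.
  apply/integrableP; split=> //.
  rewrite (eq_measure_integral (distribution P (rv_pair X Y))); last first.
    by move=> A mA _; exact/esym/lawE.
  rewrite ge0_integral_distribution//; last exact: measurableT_comp.
  by case/integrableP: iFG.
rewrite /Rintegral.
transitivity (fine (\int[m1 \x m2]_z H z)%E).
  congr fine; transitivity (\int[distribution P (rv_pair X Y)]_z H z)%E.
    by rewrite integral_distribution.
  by apply: eq_measure_integral => A mA _; exact: lawE.
rewrite -integral12_prod_meas1// /fubini_F.
have iG' : m2.-integrable setT (EFin \o G).
  apply/integrableP; split; first exact/measurable_EFinP.
  rewrite ge0_integral_distribution//; first by case/integrableP: iG.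
  by apply: measurableT_comp => //; exact/measurable_EFinP.
have GE : (\int[m2]_y (G y)%:E = \int[P]_w (G (Y w))%:E)%E.
  by rewrite (@integral_distribution _ _ _ _ _ P Y (EFin \o G))//; exact/measurable_EFinP.
have FE : (\int[m1]_y (F y)%:E = \int[P]_w (F (X w))%:E)%E.
  by rewrite (@integral_distribution _ _ _ _ _ P X (EFin \o F))//; exact/measurable_EFinP.
have iF' : m1.-integrable setT (EFin \o F).
  apply/integrableP; split; first exact/measurable_EFinP.
  rewrite ge0_integral_distribution//; first by case/integrableP: iF.
  by apply: measurableT_comp => //; exact/measurable_EFinP.
have inner x : (\int[m2]_y H (x, y) = (F x)%:E * \int[P]_w (G (Y w))%:E)%E.
  rewrite -GE -integralZl//.
rewrite (eq_integral _ _ (fun x _ => inner x)).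
have fG : (\int[P]_w (G (Y w))%:E)%E \is a fin_num by exact: integrable_fin_num.
rewrite -(fineK fG) integralZr// FE fineM//.
exact: integrable_fin_num.
Qed.

End independence.

Section iid_sums.
Context d (T : measurableType d) (R : realType) (P : probability T R).
Context d' (W : measurableType d').
Variables (J : nat -> {mfun T >-> W}) (J0 : {mfun T >-> W}).
Hypothesis indepJ : mutually_independent P (fun i => sigma_of (J i)).
Hypothesis lawJ : forall i, same_law P (J i) J0.

Lemma iid_sum_integrable (F : W -> R) N : measurable_fun setT F ->
  P.-integrable setT (EFin \o (F \o J0)) ->
  P.-integrable setT (EFin \o (fun w => \sum_(i < N) F (J i w))).
Proof.
move=> mF iF.
rewrite (_ : _ \o _ = (fun w => \sum_(i < N) (F (J i w))%:E)%E).
  apply: integrable_sum => // i _.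
  exact: (same_law_integrable (lawJ i) mF iF).
by apply/funext => w /=; rewrite sumEFin.
Qed.

Lemma iid_sum_integral (F : W -> R) N : measurable_fun setT F ->
  P.-integrable setT (EFin \o (F \o J0)) ->
  \int[P]_w (\sum_(i < N) F (J i w)) = N%:R * \int[P]_w F (J0 w).
Proof.
move=> mF iF; elim: N => [|N IH].
  under eq_Rintegral do rewrite big_ord0.
  by rewrite Rintegral_cst// mul0r mul0r.
under eq_Rintegral do rewrite big_ord_recr/=.
rewrite RintegralD//; [|exact: iid_sum_integrable|
  exact: (same_law_integrable (lawJ N) mF iF)].
by rewrite IH (same_law_Rintegral (lawJ N))// -natr1 mulrDl mul1r.
Qed.

Lemma iid_Lfun2 (F : W -> R) i : measurable_fun setT F ->
  P.-integrable setT (EFin \o (fun w => F (J0 w) ^+ 2)) ->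
  (fun w => F (J i w)) \in Lfun P 2%:E.
Proof.
move=> mF iF; apply: integrable_sqr_Lfun2; first exact: measurableT_comp.
exact: (same_law_integrable (lawJ i) (measurable_funX 2 mF) iF).
Qed.

Lemma iid_uncorrelated (F : W -> R) i j : measurable_fun setT F ->
  P.-integrable setT (EFin \o (fun w => F (J0 w) ^+ 2)) -> i != j ->
  \int[P]_w (F (J i w) * F (J j w)) = (\int[P]_w F (J0 w)) ^+ 2.
Proof.
move=> mF iF ij.
have L k := iid_Lfun2 k mF iF.
have L1 k : P.-integrable setT (EFin \o (F \o J k)).
  apply/Lfun1_integrable.
  exact: (Lfun_subset12 (fin_num_measure P _ measurableT) (L k)).
rewrite (independent_integralM (X := J i) (Y := J j)) //.
- by rewrite !(same_law_Rintegral (lawJ _)).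
- move=> A B mA mB; apply: (mutually_independent2 indepJ ij).
  + by exists A => //; rewrite setTI.
  + by exists B => //; rewrite setTI.
- by apply/Lfun1_integrable; exact: Lfun2_mul_Lfun1 (L i) (L j).
Qed.

Lemma iid_sum_Lfun2 (F : W -> R) N : measurable_fun setT F ->
  P.-integrable setT (EFin \o (fun w => F (J0 w) ^+ 2)) ->
  (fun w => \sum_(i < N) F (J i w)) \in Lfun P 2%:E.
Proof.
move=> mF iF.
rewrite (_ : (fun w => _) = \sum_(i < N) (fun w => F (J i w))).
  by apply: rpred_sum; rewrite ?lee1n// => ? i _; exact: iid_Lfun2.
by apply/funext => w; rewrite fct_sumE.
Qed.

(** Bienayme's identity: independence kills the cross terms. *)
Lemma iid_sum_sqr_integral (F : W -> R) N : measurable_fun setT F ->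
  P.-integrable setT (EFin \o (fun w => F (J0 w) ^+ 2)) ->
  \int[P]_w F (J0 w) = 0 ->
  \int[P]_w ((\sum_(i < N) F (J i w)) ^+ 2) = N%:R * \int[P]_w (F (J0 w) ^+ 2).
Proof.
move=> mF iF F0.
have mF2 : measurable_fun setT (fun x => F x ^+ 2) by exact: measurable_funX.
have prod0 i j : i != j -> \int[P]_w (F (J i w) * F (J j w)) = 0.
  by move=> ij; rewrite iid_uncorrelated// F0 expr0n.
have iprod i j : P.-integrable setT (EFin \o (fun w => F (J i w) * F (J j w))).
  by apply/Lfun1_integrable; apply: Lfun2_mul_Lfun1; exact: iid_Lfun2.
have cross (n k : nat) : (k <= n)%N ->
    P.-integrable setT (EFin \o (fun w => (\sum_(i < k) F (J i w)) * F (J n w))) /\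
    \int[P]_w ((\sum_(i < k) F (J i w)) * F (J n w)) = 0.
  elim: k => [_|k IH kn].
    have -> : (fun w => (\sum_(i < 0) F (J i w)) * F (J n w)) = cst 0.
      by apply/funext => w; rewrite big_ord0 mul0r.
    by split; [exact: finite_measure_integrable_cst|rewrite Rintegral_cst// mul0r].
  have [ik k0] := IH (ltnW kn).
  have -> : (fun w => (\sum_(i < k.+1) F (J i w)) * F (J n w)) =
      (fun w => (\sum_(i < k) F (J i w)) * F (J n w) + F (J k w) * F (J n w)).
    by apply/funext => w; rewrite big_ord_recr/= mulrDl.
  split.
    exact: (integrableD measurableT ik (iprod k n)).
  by rewrite RintegralD// k0 prod0 ?addr0// ltn_eqF.
elim: N => [|N IH].
  under eq_Rintegral do rewrite big_ord0 expr0n/=.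
  by rewrite Rintegral_cst// !mul0r.
have [ic c0] := cross N N (leqnn N).
have iS : P.-integrable setT (EFin \o (fun w => (\sum_(i < N) F (J i w)) ^+ 2)).
  by apply: Lfun2_integrable_sqr; exact: iid_sum_Lfun2.
have iN := same_law_integrable (lawJ N) mF2 iF.
have E w : (\sum_(i < N.+1) F (J i w)) ^+ 2 =
    (\sum_(i < N) F (J i w)) ^+ 2 +
    (2 * ((\sum_(i < N) F (J i w)) * F (J N w)) + F (J N w) ^+ 2).
  by rewrite big_ord_recr/=; ring.
under eq_Rintegral do rewrite E.
have i2c := integrableZl measurableT 2 ic.
rewrite RintegralD//; last exact: (integrableD measurableT i2c iN).
rewrite RintegralD// RintegralZl// c0 mulr0 add0r IH.
by rewrite (same_law_Rintegral (lawJ N) mF2) -natr1 mulrDl mul1r.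
Qed.

End iid_sums.

(** * Algebra of the estimator *)

Section averages.
Context (R : realFieldType).
Implicit Types (f g : nat -> R) (N : nat).

Definition avg N f : R := N%:R^-1 * \sum_(i < N) f i.

Lemma avgD N f g : avg N (fun i => f i + g i) = avg N f + avg N g.
Proof. by rewrite /avg big_split/= mulrDr. Qed.

Lemma avgZ N (k : R) f : avg N (fun i => k * f i) = k * avg N f.
Proof. by rewrite /avg -mulr_sumr mulrCA. Qed.

Lemma avg_cst N (k : R) : (0 < N)%N -> avg N (fun=> k) = k.
Proof.
move=> N0; rewrite /avg sumr_const card_ord -[k *+ N]mulr_natl mulrA mulVf ?mul1r//.
by rewrite pnatr_eq0 -lt0n.
Qed.

Lemma eq_avg N f g : f =1 g -> avg N f = avg N g.
Proof. by move=> fg; congr (_ * _); apply: eq_bigr => i _; rewrite fg. Qed.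

Lemma ler_avg N f g : (forall i, f i <= g i) -> avg N f <= avg N g.
Proof.
by move=> fg; rewrite ler_wpM2l ?invr_ge0 ?ler0n//; apply: ler_sum => i _.
Qed.

Lemma ler_norm_avg N f : `|avg N f| <= avg N (fun i => `|f i|).
Proof.
rewrite /avg normrM ger0_norm ?invr_ge0 ?ler0n//.
by rewrite ler_wpM2l ?invr_ge0 ?ler0n// ler_norm_sum.
Qed.

Lemma avg_ge0 N f : (forall i, 0 <= f i) -> 0 <= avg N f.
Proof. by move=> f0; rewrite mulr_ge0 ?invr_ge0 ?ler0n// sumr_ge0. Qed.

(** The empirical variance is nonnegative. *)
Lemma sqr_avg_le N f : (0 < N)%N -> avg N f ^+ 2 <= avg N (fun i => f i ^+ 2).
Proof.
move=> N0; have := avg_ge0 N (fun i => sqr_ge0 (f i - avg N f)).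
have -> : avg N (fun i => (f i - avg N f) ^+ 2) =
    avg N (fun i => f i ^+ 2 + ((- 2 * avg N f) * f i + avg N f ^+ 2)).
  by apply: eq_avg => i; ring.
by rewrite avgD avgD avgZ avg_cst//; lra.
Qed.

End averages.

Section estimator_algebra.
Context (R : rcfType).

(** The empirical covariance and variance whose ratio is the estimator. *)
Definition est_num N (a b : nat -> R) : R :=
  avg N (fun i => a i * b i) - avg N (fun i => (a i + b i) / 2) ^+ 2.

Definition est_den N (a b : nat -> R) : R :=
  avg N (fun i => (a i ^+ 2 + b i ^+ 2) / 2)
  - avg N (fun i => (a i + b i) / 2) ^+ 2.

(* [x] and [y] stand for the centred outputs and [p], [q] for their
   perturbations *)
Variables (N : nat) (N0 : (0 < N)%N) (mu S v : R) (x y p q : nat -> R).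

Let a i := mu + x i + p i.
Let b i := mu + y i + q i.
Let m := avg N (fun i => (x i + p i + (y i + q i)) / 2).
Let m0 := avg N (fun i => (x i + y i) / 2).
Let G i : R := (`|x i| + `|y i|) * (`|p i| + `|q i|) + 2 * (p i ^+ 2 + q i ^+ 2).
Let s : R := Num.sqrt N%:R.
Let H := s * (avg N G + 2 * m0 ^+ 2).

Let meanE : avg N (fun i => (a i + b i) / 2) = mu + m.
Proof.
rewrite (eq_avg _ (g := fun i => mu + (x i + p i + (y i + q i)) / 2)).
  by rewrite avgD avg_cst.
by move=> i; rewrite /a /b; field.
Qed.

(** Both statistics are invariant under a common translation of the sample. *)
Lemma est_numE :
  est_num N a b = avg N (fun i => (x i + p i) * (y i + q i)) - m ^+ 2.
Proof.
rewrite /est_num meanE (eq_avg _ (g := fun i => (x i + p i) * (y i + q i) +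
  ((2 * mu) * ((x i + p i + (y i + q i)) / 2) + mu ^+ 2))).
  by rewrite avgD avgD avgZ avg_cst// -/m; ring.
by move=> i; rewrite /a /b; field.
Qed.

Lemma est_denE :
  est_den N a b = avg N (fun i => ((x i + p i) ^+ 2 + (y i + q i) ^+ 2) / 2) - m ^+ 2.
Proof.
rewrite /est_den meanE (eq_avg _ (g := fun i =>
  ((x i + p i) ^+ 2 + (y i + q i) ^+ 2) / 2 +
  ((2 * mu) * ((x i + p i + (y i + q i)) / 2) + mu ^+ 2))).
  by rewrite avgD avgD avgZ avg_cst// -/m; ring.
by move=> i; rewrite /a /b; field.
Qed.

Let m2_le : m ^+ 2 <= 2 * m0 ^+ 2 + avg N (fun i => p i ^+ 2 + q i ^+ 2).
Proof.
pose k := avg N (fun i => (p i + q i) / 2).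
have mE : m = m0 + k.
  by rewrite -avgD; apply: eq_avg => i; field.
have h1 : (m0 + k) ^+ 2 <= 2 * m0 ^+ 2 + 2 * k ^+ 2.
  by have := sqr_ge0 (m0 - k); lra.
rewrite mE (le_trans h1)// lerD2l.
have h2 : k ^+ 2 <= avg N (fun i => ((p i + q i) / 2) ^+ 2) by exact: sqr_avg_le.
apply: (@le_trans _ _ (2 * avg N (fun i => ((p i + q i) / 2) ^+ 2))).
  by rewrite ler_wpM2l.
rewrite -avgZ; apply: ler_avg => i.
by have := sqr_ge0 (p i - q i); lra.
Qed.

Let s1 : 1 <= s.
Proof. by rewrite /s -[X in X <= _]sqrtr1 ler_wsqrtr// ler1n. Qed.

Let pq_le i : 2 * `|p i * q i| <= p i ^+ 2 + q i ^+ 2.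
Proof.
rewrite normrM -(real_normK (num_real (p i))) -(real_normK (num_real (q i))).
by have := sqr_ge0 (`|p i| - `|q i|); nra.
Qed.

(** The numerator of the estimation error differs from an average of the
    influence function by the products involving a perturbation and by the
    square of the mean of the centred sample; all of them are dominated by
    one quantity [H], whose expectation is easy to bound. *)
Lemma est_remainder_le :
  `|s * (est_num N a b - S * est_den N a b) -
    s * avg N (fun i => x i * y i - S * ((x i ^+ 2 + y i ^+ 2) / 2))| <=
  (1 + `|S|) * H.
Proof.
pose g i := x i * q i + p i * y i + p i * q i -
  S * (x i * p i + y i * q i + (p i ^+ 2 + q i ^+ 2) / 2).
have -> : s * (est_num N a b - S * est_den N a b) -
    s * avg N (fun i => x i * y i - S * ((x i ^+ 2 + y i ^+ 2) / 2)) =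
    s * (avg N g - (1 - S) * m ^+ 2).
  rewrite -mulrBr; congr (_ * _); rewrite est_numE est_denE.
  have -> : avg N g = avg N (fun i => (x i + p i) * (y i + q i)) +
      (- S * avg N (fun i => ((x i + p i) ^+ 2 + (y i + q i) ^+ 2) / 2) +
       -1 * avg N (fun i => x i * y i - S * ((x i ^+ 2 + y i ^+ 2) / 2))).
    by rewrite -!avgZ -!avgD; apply: eq_avg => i; rewrite /g; field.
  by ring.
rewrite normrM (ger0_norm (le_trans ler01 s1)) /H [leRHS]mulrCA.
apply: ler_wpM2l; first exact: le_trans ler01 s1.
apply: (le_trans (ler_normB _ _)).
pose g' i := (`|x i| + `|y i|) * (`|p i| + `|q i|) + (p i ^+ 2 + q i ^+ 2).
have gle : `|avg N g| <= (1 + `|S|) * avg N g'.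
  apply: (le_trans (ler_norm_avg _ _)); rewrite -avgZ; apply: ler_avg => i.
  rewrite /g (le_trans (ler_normB _ _))// [leRHS]mulrDl mul1r lerD//.
    apply: (le_trans (ler_normD _ _)); rewrite lerD//.
      apply: (le_trans (ler_normD _ _)); rewrite !normrM.
      have := normr_ge0 (x i); have := normr_ge0 (y i).
      have := normr_ge0 (p i); have := normr_ge0 (q i); nra.
    have := pq_le i; have := normr_ge0 (p i * q i); lra.
  rewrite normrM ler_wpM2l//.
  apply: (le_trans (ler_normD _ _)); rewrite lerD//.
    apply: (le_trans (ler_normD _ _)); rewrite !normrM.
    have := normr_ge0 (x i); have := normr_ge0 (y i).
    have := normr_ge0 (p i); have := normr_ge0 (q i); nra.
  have := sqr_ge0 (p i); have := sqr_ge0 (q i).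
  by rewrite ger0_norm; nra.
have mle : `|(1 - S) * m ^+ 2| <=
    (1 + `|S|) * (2 * m0 ^+ 2 + avg N (fun i => p i ^+ 2 + q i ^+ 2)).
  rewrite normrM (ger0_norm (sqr_ge0 m)) ler_pM// ?sqr_ge0//.
  by rewrite (le_trans (ler_normB _ _))// normr1.
apply: (le_trans (lerD gle mle)).
rewrite -mulrDr ler_wpM2l ?addr_ge0//.
have -> : avg N G = avg N g' + avg N (fun i => p i ^+ 2 + q i ^+ 2).
  by rewrite -avgD; apply: eq_avg => i; rewrite /G /g'; ring.
lra.
Qed.

Lemma est_den_le :
  `|est_den N a b - v| <= `|avg N (fun i => (x i ^+ 2 + y i ^+ 2) / 2 - v)| + H.
Proof.
pose g i := x i * p i + y i * q i + (p i ^+ 2 + q i ^+ 2) / 2.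
have -> : est_den N a b - v =
    avg N (fun i => (x i ^+ 2 + y i ^+ 2) / 2 - v) + (avg N g - m ^+ 2).
  rewrite est_denE [RHS]addrA -[X in _ = X - _]avgD addrAC; congr (_ - _).
  rewrite -[X in _ - X](avg_cst v N0) -mulN1r -avgZ -avgD.
  by apply: eq_avg => i; rewrite /g; field.
apply: (le_trans (ler_normD _ _)); rewrite lerD2l.
apply: (le_trans (ler_normB _ _)).
pose g' i := (`|x i| + `|y i|) * (`|p i| + `|q i|) + (p i ^+ 2 + q i ^+ 2).
have gle : `|avg N g| <= avg N g'.
  apply: (le_trans (ler_norm_avg _ _)); apply: ler_avg => i.
  apply: (le_trans (ler_normD _ _)); rewrite lerD//.
    apply: (le_trans (ler_normD _ _)); rewrite !normrM.
    have := normr_ge0 (x i); have := normr_ge0 (y i).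
    have := normr_ge0 (p i); have := normr_ge0 (q i); nra.
  have := sqr_ge0 (p i); have := sqr_ge0 (q i).
  by rewrite ger0_norm; nra.
have mle := m2_le; rewrite -(ger0_norm (sqr_ge0 m)) in mle.
apply: (le_trans (lerD gle mle)).
have GE : avg N G = avg N g' + avg N (fun i => p i ^+ 2 + q i ^+ 2).
  by rewrite -avgD; apply: eq_avg => i; rewrite /G /g'; ring.
have GH : avg N G + 2 * m0 ^+ 2 <= H.
  rewrite /H ler_peMl//; apply: addr_ge0; last by rewrite mulr_ge0 ?sqr_ge0.
  by apply: avg_ge0 => i; rewrite addr_ge0 ?mulr_ge0 ?addr_ge0 ?sqr_ge0.
by lra.
Qed.

End estimator_algebra.

(** The ratio [U / D] linearised at the limit [v] of [D]: the bound is the sum of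
    an error in the numerator and of the product of [w], which stays bounded in
    probability, by the error in the denominator. *)
Lemma ratio_linearization (R : realFieldType) (s S v U D w h z K : R) : 0 < v ->
  `|s * (U - S * D) - w| <= K * h -> `|D - v| <= z -> z < v / 2 ->
  `|s * (U / D - S) - w / v| <= 2 / v * (K * h) + 2 / v ^+ 2 * (`|w| * z).
Proof.
move=> v0 hr hD zv.
have D0 : v / 2 < D.
  have := le_lt_trans hD zv; rewrite ltr_norml => /andP[]; lra.
have Dp : 0 < D by rewrite (lt_trans _ D0)// divr_gt0.
have -> : s * (U / D - S) - w / v =
    (s * (U - S * D) - w) / D + w * (v - D) / (D * v).
  by field; rewrite !gt_eqF.
have Di : D^-1 <= 2 / v.
  by rewrite -[2 / v]invf_div lef_pV2 ?posrE ?divr_gt0// ltW.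
apply: (le_trans (ler_normD _ _)); apply: lerD.
  rewrite normrM (ger0_norm (x := D^-1)); last by rewrite invr_ge0 ltW.
  by rewrite [leRHS]mulrC; apply: ler_pM => //; rewrite invr_ge0 ltW.
have Dv0 : 0 <= (D * v)^-1 by rewrite invr_ge0 mulr_ge0 ?ltW.
rewrite !normrM distrC (ger0_norm Dv0).
have h1 : (D * v)^-1 <= 2 / v ^+ 2.
  by rewrite invfM expr2 invfM mulrA ler_wpM2r// invr_ge0 ltW.
rewrite [leRHS]mulrC; apply: ler_pM => //.
by rewrite ler_wpM2l.
Qed.

(** * Asymptotic linearity of the estimator *)

(** Writing the inverse as [x * (x ^ 2) ^ (-1)] reduces it to a real power of a
    nonnegative number, with the convention that the inverse of 0 is 0. *)
Lemma measurable_invr (R : realType) : measurable_fun setT (fun x : R => x^-1).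
Proof.
have -> : (fun x : R => x^-1) = (fun x => x * (x ^+ 2) `^ (-1)).
  apply/funext => x; have [->|x0] := eqVneq x 0; first by rewrite invr0 mul0r.
  by rewrite powR_inv1 ?sqr_ge0// expr2 invfM mulrA mulfV// mul1r.
apply: measurable_funM => //; apply: (measurableT_comp (measurable_powR (-1))).
exact: measurable_funX.
Qed.

Lemma sobol_estimatorE (R : realType) (v0 : R) N (a b : nat -> R) :
  sobol_estimator v0 N a b =
  if est_den N a b == 0 then v0 else est_num N a b / est_den N a b.
Proof. by []. Qed.

Lemma measurable_sobol_estimator d (T : measurableType d) (R : realType)
    (v0 : R) N (A B : nat -> T -> R) :
  (forall i, measurable_fun setT (A i)) ->
  (forall i, measurable_fun setT (B i)) ->
  measurable_fun setT
    (fun w => sobol_estimator v0 N (fun i => A i w) (fun i => B i w)).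
Proof.
move=> mA mB.
pose mean w := N%:R^-1 * \sum_(i < N) (A i w + B i w) / 2.
pose num w := N%:R^-1 * (\sum_(i < N) A i w * B i w) - mean w ^+ 2.
pose den w := N%:R^-1 * (\sum_(i < N) (A i w ^+ 2 + B i w ^+ 2) / 2) - mean w ^+ 2.
have mmean : measurable_fun setT mean.
  apply: measurable_funM => //; apply: measurable_sum => i.
  by apply: measurable_funM => //; exact: measurable_funD.
have mnum : measurable_fun setT num.
  apply: measurable_funB; last exact: measurable_funX.
  apply: measurable_funM => //; apply: measurable_sum => i.
  exact: measurable_funM.
have mden : measurable_fun setT den.
  apply: measurable_funB; last exact: measurable_funX.
  apply: measurable_funM => //; apply: measurable_sum => i.
  by apply: measurable_funM => //; apply: measurable_funD; exact: measurable_funX.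
apply: (measurable_fun_ifT (f := fun w => den w == 0) (g := cst v0)
  (h := fun w => num w / den w)) => //.
  exact: measurable_fun_eqr.
apply: measurable_funM => //.
exact: (measurableT_comp (@measurable_invr R) mden).
Qed.

Section vanishing_bound.
Context (R : realType).

(** The inequality [2 x y <= eta x ^ 2 + y ^ 2 / eta] in place of
    Cauchy-Schwarz: the weight [eta] is chosen small first, then [N] large. *)
Lemma cvg0_weighted_bound (c kappa : nat -> R) (K : R) :
  0 <= K -> (forall N, 0 <= c N) ->
  (forall eta : R, 0 < eta -> forall N, (0 < N)%N ->
    c N <= eta * K + (2 / eta + 2) * kappa N) ->
  kappa N @[N --> \oo] --> 0 -> c N @[N --> \oo] --> 0.
Proof.
move=> K0 c0 cle k0; apply/cvgrPdist_le => e e0.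
pose eta := e / (2 * (K + 1)).
have K1 : 0 < K + 1 by rewrite ltr_wpDl.
have eta0 : 0 < eta by rewrite divr_gt0// mulr_gt0.
have M0 : 0 < 2 / eta + 2 by rewrite addr_gt0// divr_gt0.
have d0 : 0 < e / 2 / (2 / eta + 2) by rewrite !divr_gt0.
move/cvgrPdist_le : k0 => /(_ _ d0) k0.
near=> N.
have N0 : (0 < N)%N by near: N; exact: nbhs_infty_gt.
have : `|0 - kappa N| <= e / 2 / (2 / eta + 2) by near: N; exact: k0.
rewrite !sub0r !normrN => kN.
rewrite ger0_norm// (le_trans (cle eta eta0 N N0))// (splitr e) lerD//.
  rewrite /eta -[X in _ <= X]mulr1 [X in X <= _](_ : _ = e / 2 * (K / (K + 1))).
    apply: ler_wpM2l; first by rewrite divr_ge0 ?ltW.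
    by rewrite ler_pdivrMr// mul1r lerDl.
  by field; rewrite gt_eqF.
apply: (@le_trans _ _ ((2 / eta + 2) * `|kappa N|)).
  by apply: ler_wpM2l; [exact: ltW|exact: ler_norm].
by rewrite mulrC -ler_pdivlMr.
Unshelve. all: by end_near. Qed.

End vanishing_bound.

Lemma cvg_invr_sqrtn (R : realType) :
  (Num.sqrt N%:R)^-1 @[N --> \oo] --> (0 : R).
Proof.
apply/cvgrPdist_le => e e0; near=> N.
rewrite sub0r normrN ger0_norm ?invr_ge0 ?sqrtr_ge0//.
have h : e^-1 <= Num.sqrt N%:R.
  have ei : 0 <= e^-1 by rewrite invr_ge0 ltW.
  rewrite -(ger0_norm ei) -sqrtr_sqr ler_wsqrtr//.
  by near: N; exact: nbhs_infty_ger.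
by rewrite -[e]invrK lef_pV2 ?posrE ?invr_gt0// (lt_le_trans _ h) ?invr_gt0.
Unshelve. all: by end_near. Qed.

Section asymptotic_linearity.
Context d (T : measurableType d) (R : realType) (P : probability T R).
Context d' (W : measurableType d').
Variables (J : nat -> {mfun T >-> W}) (J0 : {mfun T >-> W}).
Hypothesis indepJ : mutually_independent P (fun i => sigma_of (J i)).
Hypothesis lawJ : forall i, same_law P (J i) J0.
Variables (v0 mu S v : R) (a b : W -> R) (p q : nat -> W -> R).
Hypotheses (ma : measurable_fun setT a) (mb : measurable_fun setT b).
Hypotheses (mp : forall N, measurable_fun setT (p N))
  (mq : forall N, measurable_fun setT (q N)).
Hypotheses (a4 : (fun w => a (J0 w) ^+ 2) \in Lfun P 2%:E)
  (b4 : (fun w => b (J0 w) ^+ 2) \in Lfun P 2%:E).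
Hypotheses (p2 : forall N, (0 < N)%N -> (fun w => p N (J0 w)) \in Lfun P 2%:E)
  (q2 : forall N, (0 < N)%N -> (fun w => q N (J0 w)) \in Lfun P 2%:E).
Hypotheses (a0 : \int[P]_w a (J0 w) = 0) (b0 : \int[P]_w b (J0 w) = 0).
Hypothesis ab : \int[P]_w (a (J0 w) * b (J0 w)) = S * v.
Hypothesis a2b2 : \int[P]_w ((a (J0 w) ^+ 2 + b (J0 w) ^+ 2) / 2) = v.
Hypothesis vgt0 : 0 < v.
Hypotheses (Np : N%:R * \int[P]_w (p N (J0 w) ^+ 2) @[N --> \oo] --> (0 : R))
  (Nq : N%:R * \int[P]_w (q N (J0 w) ^+ 2) @[N --> \oo] --> (0 : R)).

Implicit Types F G : W -> R.

Let int (F : W -> R) := P.-integrable setT (EFin \o (fun w => F (J0 w))).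
Let E (F : W -> R) := \int[P]_w F (J0 w).

Let intD F G : int F -> int G -> int (fun x => F x + G x).
Proof. by move=> iF iG; exact: (integrableD measurableT iF iG). Qed.

Let intZ k F : int F -> int (fun x => k * F x).
Proof. by move=> iF; exact: (integrableZl measurableT k iF). Qed.

Let int_cst k : int (fun=> k).
Proof. exact: finite_measure_integrable_cst. Qed.

Let int_le F G : measurable_fun setT F -> (forall x, `|F x| <= G x) -> int G -> int F.
Proof.
move=> mF FG iG; apply: le_integrable iG => //.
  by apply/measurable_EFinP; exact: (measurableT_comp mF).
by move=> w _ /=; rewrite lee_fin (le_trans (FG _))// ler_norm.
Qed.

Let E_D F G : int F -> int G -> E (fun x => F x + G x) = E F + E G.
Proof. by move=> iF iG; exact: (RintegralD measurableT iF iG). Qed.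

Let E_Z k F : int F -> E (fun x => k * F x) = k * E F.
Proof. by move=> iF; exact: (RintegralZl k measurableT iF). Qed.

Let L2_int F : (fun w => F (J0 w)) \in Lfun P 2%:E -> int (fun x => F x ^+ 2).
Proof. by move=> /Lfun2_integrable_sqr. Qed.

Let L2_int1 F : (fun w => F (J0 w)) \in Lfun P 2%:E -> int F.
Proof.
move=> FL; apply/Lfun1_integrable.
exact: (Lfun_subset12 (fin_num_measure P _ measurableT) FL).
Qed.

Let ia2 : int (fun x => a x ^+ 2). Proof. exact: L2_int1 a4. Qed.
Let ib2 : int (fun x => b x ^+ 2). Proof. exact: L2_int1 b4. Qed.
Let ip2 N : (0 < N)%N -> int (fun x => p N x ^+ 2).
Proof. by move=> N0; exact: L2_int (p2 N0). Qed.
Let iq2 N : (0 < N)%N -> int (fun x => q N x ^+ 2).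
Proof. by move=> N0; exact: L2_int (q2 N0). Qed.
Let ia4 : int (fun x => (a x ^+ 2) ^+ 2). Proof. exact: (L2_int a4). Qed.
Let ib4 : int (fun x => (b x ^+ 2) ^+ 2). Proof. exact: (L2_int b4). Qed.

(* The averages of the centred summands [c], [zeta] and [zeta2] drive the
   estimator; [G] dominates the summands involving the perturbations. *)
Let c x := (a x + b x) / 2.
Let zeta x := a x * b x - S * ((a x ^+ 2 + b x ^+ 2) / 2).
Let zeta2 x := (a x ^+ 2 + b x ^+ 2) / 2 - v.
Let G N x := (`|a x| + `|b x|) * (`|p N x| + `|q N x|)
  + 2 * (p N x ^+ 2 + q N x ^+ 2).

Let mc : measurable_fun setT c.
Proof. by apply: measurable_funM => //; exact: measurable_funD. Qed.

Let ma2 : measurable_fun setT (fun x => a x ^+ 2).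
Proof. exact: measurable_funX. Qed.
Let mb2 : measurable_fun setT (fun x => b x ^+ 2).
Proof. exact: measurable_funX. Qed.

Let mhalf : measurable_fun setT (fun x => (a x ^+ 2 + b x ^+ 2) / 2).
Proof. by apply: measurable_funM => //; exact: measurable_funD. Qed.

Let mzeta : measurable_fun setT zeta.
Proof.
by apply: measurable_funB; [exact: measurable_funM|exact: measurable_funM].
Qed.

Let mzeta2 : measurable_fun setT zeta2.
Proof. exact: measurable_funB. Qed.

Let mG N : measurable_fun setT (G N).
Proof.
have mn (F : W -> R) : measurable_fun setT F -> measurable_fun setT (fun x => `|F x|).
  by move=> mF; exact: measurableT_comp.
apply: measurable_funD.
  by apply: measurable_funM; apply: measurable_funD; exact: mn.
by apply: measurable_funM => //; apply: measurable_funD; exact: measurable_funX.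
Qed.

Let ic2 : int (fun x => c x ^+ 2).
Proof.
apply: (int_le (G := fun x => a x ^+ 2 + b x ^+ 2)); last exact: intD.
  exact: measurable_funX.
move=> x; rewrite ger0_norm ?sqr_ge0// /c.
by have := sqr_ge0 (a x - b x); have := sqr_ge0 (a x); have := sqr_ge0 (b x); lra.
Qed.

Let iab : int (fun x => a x * b x).
Proof.
apply: (int_le (G := fun x => a x ^+ 2 + b x ^+ 2)); last exact: intD.
  exact: measurable_funM.
move=> x; rewrite normrM -(real_normK (num_real (a x))) -(real_normK (num_real (b x))).
have := sqr_ge0 (`|a x| - `|b x|).
by have := sqr_ge0 `|a x|; have := sqr_ge0 `|b x|; lra.
Qed.

Let ihalf : int (fun x => (a x ^+ 2 + b x ^+ 2) / 2).
Proof.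
have -> : (fun x => (a x ^+ 2 + b x ^+ 2) / 2) =
    (fun x => 2^-1 * (a x ^+ 2 + b x ^+ 2)).
  by apply/funext => x; rewrite mulrC.
by apply: intZ; exact: intD.
Qed.

Let ihalf2 : int (fun x => ((a x ^+ 2 + b x ^+ 2) / 2) ^+ 2).
Proof.
apply: (int_le (G := fun x => (a x ^+ 2) ^+ 2 + (b x ^+ 2) ^+ 2)); last exact: intD.
  exact: measurable_funX.
move=> x; rewrite ger0_norm ?sqr_ge0//.
have := sqr_ge0 (a x ^+ 2 - b x ^+ 2).
by have := sqr_ge0 (a x ^+ 2); have := sqr_ge0 (b x ^+ 2); lra.
Qed.

Let iab2 : int (fun x => (a x * b x) ^+ 2).
Proof.
apply: (int_le (G := fun x => (a x ^+ 2) ^+ 2 + (b x ^+ 2) ^+ 2)); last exact: intD.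
  by apply: measurable_funX; exact: measurable_funM.
move=> x; rewrite ger0_norm ?sqr_ge0// exprMn.
have := sqr_ge0 (a x ^+ 2 - b x ^+ 2).
by have := sqr_ge0 (a x ^+ 2); have := sqr_ge0 (b x ^+ 2); lra.
Qed.

Let izeta2 : int (fun x => zeta x ^+ 2).
Proof.
apply: (int_le (G := fun x => 2 * (a x * b x) ^+ 2 +
    (2 * S ^+ 2) * ((a x ^+ 2 + b x ^+ 2) / 2) ^+ 2)).
- exact: measurable_funX.
- move=> x; rewrite ger0_norm ?sqr_ge0// /zeta.
  by have := sqr_ge0 (a x * b x + S * ((a x ^+ 2 + b x ^+ 2) / 2)); lra.
- by apply: intD; exact: intZ.
Qed.

Let izeta22 : int (fun x => zeta2 x ^+ 2).
Proof.
apply: (int_le (G := fun x => 2 * ((a x ^+ 2 + b x ^+ 2) / 2) ^+ 2 + 2 * v ^+ 2)).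
- exact: measurable_funX.
- move=> x; rewrite ger0_norm ?sqr_ge0// /zeta2.
  by have := sqr_ge0 ((a x ^+ 2 + b x ^+ 2) / 2 + v); lra.
- by apply: intD => //; exact: intZ.
Qed.

Let ia1 : int a.
Proof.
by apply: L2_int1; apply: integrable_sqr_Lfun2 => //; exact: measurableT_comp.
Qed.
Let ib1 : int b.
Proof.
by apply: L2_int1; apply: integrable_sqr_Lfun2 => //; exact: measurableT_comp.
Qed.

Let Ec : E c = 0.
Proof.
have -> : c = (fun x => 2^-1 * (a x + b x)) by apply/funext => x; rewrite mulrC.
by rewrite E_Z ?E_D ?[E a]a0 ?[E b]b0 ?addr0 ?mulr0//; exact: intD.
Qed.

Let Ezeta : E zeta = 0.
Proof.
have -> : zeta = (fun x => a x * b x + (- S) * ((a x ^+ 2 + b x ^+ 2) / 2)).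
  by apply/funext => x; rewrite mulNr.
rewrite E_D//; last exact: intZ.
by rewrite E_Z// [E _]ab [E _]a2b2 mulNr subrr.
Qed.

Let Ezeta2 : E zeta2 = 0.
Proof.
rewrite E_D// [E _]a2b2 [E _]Rintegral_cst//.
by rewrite [X in fine X]probability_setT mulr1 subrr.
Qed.

Let G_le eta N x : 0 < eta -> (0 < N)%N ->
  Num.sqrt N%:R * G N x <= eta * (2 * (a x ^+ 2 + b x ^+ 2)) +
    (2 / eta + 2) * (N%:R * (p N x ^+ 2 + q N x ^+ 2)).
Proof.
move=> eta0 N0; set s : R := Num.sqrt _.
have s1 : 1 <= s by rewrite /s -[X in X <= _]sqrtr1 ler_wsqrtr// ler1n.
have -> : N%:R = s ^+ 2 :> R by rewrite sqr_sqrtr.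
set u : R := `|a x| + `|b x|; set t : R := `|p N x| + `|q N x|.
have uE : u ^+ 2 <= 2 * (a x ^+ 2 + b x ^+ 2).
  rewrite -(real_normK (num_real (a x))) -(real_normK (num_real (b x))) /u.
  by have := sqr_ge0 (`|a x| - `|b x|); lra.
have tE : t ^+ 2 <= 2 * (p N x ^+ 2 + q N x ^+ 2).
  rewrite -(real_normK (num_real (p N x))) -(real_normK (num_real (q N x))) /t.
  by have := sqr_ge0 (`|p N x| - `|q N x|); lra.
rewrite /G -/u -/t.
set A : R := a x ^+ 2 + b x ^+ 2 in uE *; set B : R := p N x ^+ 2 + q N x ^+ 2 in tE *.
have B0 : 0 <= B by rewrite addr_ge0 ?sqr_ge0.
have h1 : s * (u * t) <= eta * u ^+ 2 + eta^-1 * (s * t) ^+ 2.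
  have h : 0 <= eta^-1 * (eta * u - s * t) ^+ 2.
    by rewrite mulr_ge0 ?sqr_ge0// invr_ge0 ltW.
  have hE : eta^-1 * (eta * u - s * t) ^+ 2 =
      eta * u ^+ 2 + eta^-1 * (s * t) ^+ 2 - 2 * (s * (u * t)).
    by field; rewrite gt_eqF.
  have ut0 : 0 <= s * (u * t).
    by rewrite mulr_ge0 ?(le_trans ler01 s1)// mulr_ge0 ?addr_ge0.
  by rewrite hE in h; lra.
have h2 : eta * u ^+ 2 <= eta * (2 * A) by rewrite ler_wpM2l// ltW.
have h3 : eta^-1 * (s * t) ^+ 2 <= 2 / eta * (s ^+ 2 * B).
  have -> : 2 / eta * (s ^+ 2 * B) = eta^-1 * (s ^+ 2 * (2 * B)) by ring.
  rewrite exprMn; apply: ler_wpM2l; first by rewrite invr_ge0 ltW.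
  by apply: ler_wpM2l; rewrite ?sqr_ge0.
have h4 : s * (2 * B) <= 2 * (s ^+ 2 * B).
  by rewrite mulrCA ler_wpM2l// ler_wpM2r// expr2 ler_peMl// (le_trans ler01).
by rewrite mulrDr [(_ + 2) * _]mulrDl; lra.
Qed.

Let G_ge0 N x : 0 <= G N x.
Proof. by rewrite addr_ge0 ?mulr_ge0 ?addr_ge0 ?sqr_ge0. Qed.

Let iG N : (0 < N)%N -> int (G N).
Proof.
move=> N0; apply: (int_le (G := fun x => 1 * (2 * (a x ^+ 2 + b x ^+ 2)) +
    (2 / 1 + 2) * (N%:R * (p N x ^+ 2 + q N x ^+ 2)))) => //.
- move=> x; rewrite ger0_norm//; apply: le_trans (G_le x ltr01 N0).
  by rewrite ler_peMl// -[X in X <= _]sqrtr1 ler_wsqrtr// ler1n.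
- by apply: intD; do 2 apply: intZ; apply: intD => //; [exact: ip2|exact: iq2].
Qed.

Let EG0 : Num.sqrt N%:R * E (G N) @[N --> \oo] --> (0 : R).
Proof.
have E_ge0 F : (forall x, 0 <= F x) -> 0 <= E F.
  by move=> F0; apply: Rintegral_ge0 => w _.
apply: (cvg0_weighted_bound (K := 2 * (E (fun x => a x ^+ 2 + b x ^+ 2)))
  (kappa := fun N => N%:R * E (fun x => p N x ^+ 2) + N%:R * E (fun x => q N x ^+ 2))).
- by rewrite mulr_ge0 ?E_ge0// => x; rewrite addr_ge0 ?sqr_ge0.
- by move=> N; rewrite mulr_ge0 ?sqrtr_ge0// E_ge0.
- move=> eta eta0 N N0.
  have ipq := intD (ip2 N0) (iq2 N0).
  have iA := intD ia2 ib2.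
  rewrite -mulrDr -(E_D (ip2 N0) (iq2 N0)) -(E_Z _ (iG N0)).
  rewrite -(E_Z 2 iA) -(E_Z eta (intZ 2 iA)).
  rewrite -(E_Z N%:R ipq) -(E_Z (2 / eta + 2) (intZ N%:R ipq)).
  rewrite -E_D; [|exact/intZ/intZ|exact/intZ/intZ].
  apply: le_Rintegral => //.
  + by apply: intZ; exact: iG.
  + exact: (intD (intZ eta (intZ 2 iA)) (intZ (2 / eta + 2) (intZ N%:R ipq))).
  + by move=> w _; exact: G_le.
- rewrite -[X in _ --> X](addr0 0); exact: cvgD.
Qed.

Let root_avg F N w : R := Num.sqrt N%:R * avg N (fun i => F (J i w)).

Let mavg F N : measurable_fun setT F ->
  measurable_fun setT (fun w => avg N (fun i => F (J i w))).
Proof.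
move=> mF; apply: measurable_funM => //; apply: measurable_sum => i.
exact: measurableT_comp.
Qed.

Let avg_sqr F N : measurable_fun setT F -> int (fun x => F x ^+ 2) -> E F = 0 ->
  (0 < N)%N ->
  P.-integrable setT (EFin \o (fun w => avg N (fun i => F (J i w)) ^+ 2)) /\
  \int[P]_w (avg N (fun i => F (J i w)) ^+ 2) = N%:R^-1 * E (fun x => F x ^+ 2).
Proof.
move=> mF iF F0 N0.
have -> : (fun w => avg N (fun i => F (J i w)) ^+ 2) =
    (fun w => N%:R^-1 ^+ 2 * (\sum_(i < N) F (J i w)) ^+ 2).
  by apply/funext => w; rewrite /avg exprMn.
have iS := Lfun2_integrable_sqr (iid_sum_Lfun2 lawJ N mF iF).
split; first exact: (integrableZl measurableT _ iS).
rewrite RintegralZl// (iid_sum_sqr_integral indepJ lawJ)//.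
by rewrite expr2 -mulrA [X in _ * X]mulrA mulVf ?mul1r// pnatr_eq0 -lt0n.
Qed.

Let root_avg_sqr F N : measurable_fun setT F -> int (fun x => F x ^+ 2) ->
  E F = 0 -> (0 < N)%N ->
  P.-integrable setT (EFin \o (fun w => root_avg F N w ^+ 2)) /\
  \int[P]_w (root_avg F N w ^+ 2) = E (fun x => F x ^+ 2).
Proof.
move=> mF iF F0 N0; have [iS ES] := avg_sqr mF iF F0 N0.
have -> : (fun w => root_avg F N w ^+ 2) =
    (fun w => N%:R * avg N (fun i => F (J i w)) ^+ 2).
  by apply/funext => w; rewrite /root_avg exprMn sqr_sqrtr.
split; first exact: (integrableZl measurableT _ iS).
by rewrite RintegralZl// ES mulrA mulfV ?mul1r// pnatr_eq0 -lt0n.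
Qed.

Let mroot_avg F N : measurable_fun setT F -> measurable_fun setT (root_avg F N).
Proof. by move=> mF; apply: measurable_funM => //; exact: mavg. Qed.

Let Z N w := avg N (fun i => zeta2 (J i w)).

Let H N w := Num.sqrt N%:R * (avg N (fun i => G N (J i w))
  + 2 * avg N (fun i => c (J i w)) ^+ 2).

Let mZ N : measurable_fun setT (Z N). Proof. exact: mavg. Qed.

Let mH N : measurable_fun setT (H N).
Proof.
apply: measurable_funM => //; apply: measurable_funD; first exact: mavg.
by apply: measurable_funM => //; apply: measurable_funX; exact: mavg.
Qed.

Let H_ge0 N w : 0 <= H N w.
Proof.
apply: mulr_ge0; [exact: sqrtr_ge0|apply: addr_ge0].
  by apply: avg_ge0 => i; exact: G_ge0.
by apply: mulr_ge0 => //; exact: sqr_ge0.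
Qed.

Let cvgH : cvg_in_probability P H 0.
Proof.
have intG N : (0 < N)%N ->
    P.-integrable setT (EFin \o (fun w => avg N (fun i => G N (J i w)))) /\
    \int[P]_w avg N (fun i => G N (J i w)) = E (G N).
  move=> N0; have iS := iid_sum_integrable lawJ N (mG N) (iG N0).
  split; first exact: (integrableZl measurableT _ iS).
  rewrite RintegralZl// (iid_sum_integral lawJ N (mG N) (iG N0)).
  by rewrite mulrA mulVf ?mul1r// pnatr_eq0 -lt0n.
have intc N (N0 : (0 < N)%N) := avg_sqr mc ic2 Ec N0.
apply: cvg_proba_L1 => [N N0|].
  have [i1 _] := intG N N0; have [i2 _] := intc N N0.
  have i3 := integrableD measurableT i1 (integrableZl measurableT 2 i2).
  exact: (integrableZl measurableT (Num.sqrt N%:R) i3).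
have lim : Num.sqrt N%:R * E (G N) +
    2 * E (fun x => c x ^+ 2) * (Num.sqrt N%:R)^-1 @[N --> \oo] --> (0 : R).
  rewrite -[X in _ --> X](addr0 0); apply: cvgD => //.
  rewrite -[X in _ --> X](mulr0 (2 * E (fun x => c x ^+ 2))).
  by apply: cvgM; [exact: cvg_cst|exact: cvg_invr_sqrtn].
apply: cvg_trans lim; apply: near_eq_cvg; near=> N.
have N0 : (0 < N)%N by near: N; exact: nbhs_infty_gt.
have [i1 E1] := intG N N0; have [i2 E2] := intc N N0.
have i2' := integrableZl measurableT 2 i2.
have i3 := integrableD measurableT i1 i2'.
under [RHS]eq_Rintegral do rewrite ger0_norm//.
rewrite /H RintegralZl// RintegralD// (RintegralZl 2 measurableT i2) E1 E2.
rewrite mulrDr; congr (_ + _).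
have s0 : Num.sqrt N%:R != 0 :> R by rewrite sqrtr_eq0 -ltNge ltr0n.
have {3}-> : N%:R = Num.sqrt N%:R ^+ 2 :> R by rewrite sqr_sqrtr.
by field.
Unshelve. all: by end_near. Qed.

(* Z is a sequence bounded in L2 times 1 / sqrt N. *)
Let cvgZ : cvg_in_probability P Z 0.
Proof.
have cs : cvg_in_probability P (fun N (_ : T) => (Num.sqrt N%:R)^-1 : R) 0.
  apply: cvg_proba_L1 => [N N0|]; first exact: finite_measure_integrable_cst.
  have -> : (fun N => \int[P]_w `|(Num.sqrt N%:R)^-1|) =
      (fun N => (Num.sqrt N%:R)^-1 : R).
    apply/funext => N; rewrite Rintegral_cst// [X in fine X]probability_setT mulr1.
    by rewrite ger0_norm// invr_ge0 sqrtr_ge0.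
  exact: cvg_invr_sqrtn.
have := cvg_proba_mul_bounded (U := root_avg zeta2) (K := E (fun x => zeta2 x ^+ 2))
  (fun N _ => mroot_avg N mzeta2) (fun N _ => measurable_cst _)
  (fun N N0 => proj1 (root_avg_sqr mzeta2 izeta22 Ezeta2 N0)) _ cs.
move=> /(_ _)/wrap[].
  by move=> N N0; rewrite (proj2 (root_avg_sqr mzeta2 izeta22 Ezeta2 N0)).
apply: cvg_proba_le => [N N0|N N0|N w N0].
- exact: mZ.
- by apply: measurable_funM => //; exact: mroot_avg.
- rewrite /= /root_avg mulrAC mulfV ?mul1r//.
  by rewrite sqrtr_eq0 -ltNge ltr0n.
Qed.

(** The estimator behaves as if there were no perturbation: since
    [N E(p ^ 2)] and [N E(q ^ 2)] tend to 0, every term containing [p] or [q] is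
    [o(1 / sqrt N)] in L1.  What remains is the classical estimator, whose
    centred numerator [zeta] is of order [1 / sqrt N] in L2 and whose denominator
    tends to [v] in probability. *)
Theorem sobol_estimator_linear :
  cvg_in_probability P (fun N w =>
    Num.sqrt N%:R * (sobol_estimator v0 N
      (fun i => mu + a (J i w) + p N (J i w))
      (fun i => mu + b (J i w) + q N (J i w)) - S)
    - (Num.sqrt N%:R)^-1 * \sum_(i < N)
      ((a (J i w) * b (J i w) - S * ((a (J i w) ^+ 2 + b (J i w) ^+ 2) / 2)) / v)) 0.
Proof.
pose V N w := `|Z N w| + H N w.
pose B N w := 2 / v * ((1 + `|S|) * H N w) + 2 / v ^+ 2 * (`|root_avg zeta N w| * V N w).
have mV N : measurable_fun setT (V N).
  by apply: measurable_funD => //; exact: measurableT_comp.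
have mW N := mroot_avg N mzeta.
have mWV N : measurable_fun setT (fun w => `|root_avg zeta N w| * V N w).
  by apply: measurable_funM => //; exact: measurableT_comp.
have V_ge0 N w : 0 <= V N w by rewrite addr_ge0.
have cV : cvg_in_probability P V 0.
  apply: cvg_probaD => [N N0|N N0||]; [exact: measurableT_comp|exact: mH| |exact: cvgH].
  apply: cvg_proba_le cvgZ => [N N0|N N0|N w N0]; first exact: measurableT_comp.
    exact: mZ.
  by rewrite normr_id.
have cWV : cvg_in_probability P (fun N w => `|root_avg zeta N w| * V N w) 0.
  have := cvg_proba_mul_bounded (U := root_avg zeta) (K := E (fun x => zeta x ^+ 2))
    (fun N _ => mroot_avg N mzeta) (fun N _ => mV N)
    (fun N N0 => proj1 (root_avg_sqr mzeta izeta2 Ezeta N0)) _ cV.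
  move=> /(_ _)/wrap[].
    by move=> N N0; rewrite (proj2 (root_avg_sqr mzeta izeta2 Ezeta N0)).
  apply: cvg_proba_le => [N N0|N N0|N w N0]; first exact: mWV.
    by apply: measurable_funM.
  by rewrite [leLHS]normrM normr_id -normrM.
have cB : cvg_in_probability P B 0.
  apply: cvg_probaD => [N N0|N N0||].
  - by do 2 apply: measurable_funM.
  - by apply: measurable_funM.
  - apply: (cvg_proba_scale (2 / v) (U := fun N w => (1 + `|S|) * H N w)) => [N N0|].
      by apply: measurable_funM.
    by apply: cvg_proba_scale => // N N0; exact: mH.
  - by apply: cvg_proba_scale => // N N0; exact: mWV.
apply: (cvg_proba_cover _ _ _ _ cV cB) => [N N0|N N0|N N0|e e0].
- apply: measurable_funB; last first.
    apply: measurable_funM => //; apply: measurable_sum => i.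
    exact: (measurableT_comp (measurable_funM mzeta (measurable_cst v^-1))).
  apply: measurable_funM => //; apply: measurable_funB => //.
  apply: measurable_sobol_estimator => i; apply: measurable_funD.
  + by apply: measurable_funD => //; exact: measurableT_comp.
  + exact: measurableT_comp.
  + by apply: measurable_funD => //; exact: measurableT_comp.
  + exact: measurableT_comp.
- exact: mV.
- apply: measurable_funD.
    by do 2 apply: measurable_funM.
  by apply: measurable_funM.
(* off the event v / 2 <= V, the denominator of the estimator exceeds v / 2 *)
exists (v / 2), e; split; rewrite ?divr_gt0// => N w N0 ew.
have [?|Vv] := leP (v / 2) `|V N w|; [by left|right].
rewrite ger0_norm// in Vv.
apply: (le_trans ew); apply: le_trans (ler_norm _).
set x := fun i => a (J i w); set y := fun i => b (J i w).
set p' := fun i => p N (J i w); set q' := fun i => q N (J i w).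
have hr := est_remainder_le N0 mu S x y p' q'.
have hD := est_den_le N0 mu v x y p' q'.
have := ratio_linearization vgt0 hr hD Vv.
have sumE : root_avg zeta N w / v = (Num.sqrt N%:R)^-1 *
    \sum_(i < N) (a (J i w) * b (J i w) -
      S * ((a (J i w) ^+ 2 + b (J i w) ^+ 2) / 2)) / v.
  rewrite -mulr_suml mulrA; congr (_ * _); rewrite /root_avg /avg mulrA.
  congr (_ * _); have {2}-> : N%:R = Num.sqrt N%:R ^+ 2 :> R by rewrite sqr_sqrtr.
  by field; rewrite sqrtr_eq0 -ltNge ltr0n.
rewrite -sumE; set den := est_den N _ _ => le_ratio.
have den0 : 0 < den.
  have : `|den - v| < v / 2 by exact: le_lt_trans hD Vv.
  rewrite ltr_norml ltrBrDr => /andP[+ _]; apply: le_lt_trans.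
  by rewrite [X in _ + X](splitr v) addrA addNr add0r divr_ge0// ltW.
suff -> : sobol_estimator v0 N (fun i => mu + a (J i w) + p N (J i w))
  (fun i => mu + b (J i w) + q N (J i w)) =
  est_num N (fun i => mu + x i + p' i) (fun i => mu + y i + q' i) / den by [].
by rewrite sobol_estimatorE gt_eqF.
Qed.

End asymptotic_linearity.

(** * Integration against a density *)

Section change_of_density.
Context d (T : measurableType d) (R : realType).
Variables (mu nu : {measure set T -> \bar R}) (rho : T -> R).
Hypotheses (mrho : measurable_fun setT rho) (rho0 : forall x, 0 <= rho x).
Hypothesis nuE : forall A, measurable A ->
  (nu A = \int[mu]_(x in A) (rho x)%:E)%E.
Local Open Scope ereal_scope.

Let mrhoE : measurable_fun setT (EFin \o rho). Proof. exact/measurable_EFinP. Qed.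

Import HBNNSimple.

Let integral_density_nnsfun (f : {nnsfun T >-> R}) :
  \int[nu]_x (f x)%:E = \int[mu]_x ((f x)%:E * (rho x)%:E).
Proof.
under [LHS]eq_integral do rewrite fimfunE -fsumEFin//.
rewrite [LHS]ge0_integral_fsum//; last 2 first.
  - by move=> r; exact/measurable_EFinP/measurableT_comp.
  - by move=> n x _; rewrite EFinM nnfun_muleindic_ge0.
under [RHS]eq_integral.
  move=> x xD; rewrite fimfunE -fsumEFin// muleC ge0_mule_fsumr; last first.
    by move=> r; rewrite EFinM nnfun_muleindic_ge0.
  over.
rewrite [RHS]ge0_integral_fsum//; last 2 first.
  - move=> r; apply: emeasurable_funM => //.
    by apply/measurable_EFinP; do 2 apply/measurableT_comp => //.
  - move=> n x _; apply: mule_ge0; first by rewrite lee_fin.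
    by rewrite EFinM nnfun_muleindic_ge0.
apply: eq_fsbigr => r; rewrite inE => -[x0 _ fx0].
have r0 : (0 <= r)%R by rewrite -fx0.
have mA : measurable (f @^-1` [set r]) by [].
transitivity (r%:E * nu (f @^-1` [set r])).
  by rewrite integralZl_indic_nnsfun// integral_indic// setIT.
rewrite nuE// -ge0_integralZl//; last 2 first.
- exact: measurable_funTS.
- by move=> x _; rewrite lee_fin.
rewrite [LHS]integral_mkcond; apply: eq_integral => x _.
rewrite patchE indicE; case: ifPn => _; last by rewrite mulr0 mule0.
by rewrite mulr1 muleC.
Qed.

(** Both sides are continuous along increasing sequences of simple functions, for
    which the identity is the definition of the density. *)
Lemma ge0_integral_density (F : T -> \bar R) : measurable_fun setT F ->
  (forall x, 0 <= F x) -> \int[nu]_x F x = \int[mu]_x (F x * (rho x)%:E).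
Proof.
move=> mF F0; pose f_ := nnsfun_approx measurableT mF.
have cvgF x : (f_ n x)%:E @[n --> \oo] --> F x by exact: cvg_nnsfun_approx.
transitivity (lim (\int[nu]_x (f_ n x)%:E @[n --> \oo])).
  rewrite -monotone_convergence//=.
  - by apply: eq_integral => x _; apply/esym/cvg_lim => //; exact: cvgF.
  - by move=> n; exact/measurable_EFinP/measurable_funTS.
  - by move=> n ? _; rewrite lee_fin.
  - by move=> ? _ ? ? mn; rewrite lee_fin; exact/lefP/nd_nnsfun_approx.
transitivity (lim (\int[mu]_x ((f_ n x)%:E * (rho x)%:E) @[n --> \oo])).
  by apply: congr_lim; apply/funext => n; exact: integral_density_nnsfun.
rewrite -monotone_convergence//=.
- apply: eq_integral => x _; apply/cvg_lim => //.
  by apply: cvgeZr => //; exact: cvgF.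
- move=> n; apply: emeasurable_funM => //.
  exact/measurable_EFinP/measurable_funTS.
- by move=> n ? _; rewrite mule_ge0// lee_fin.
- move=> x _ ? ? mn; rewrite lee_wpmul2r ?lee_fin//.
  exact/lefP/nd_nnsfun_approx.
Qed.

Lemma integrable_density (F : T -> R) : measurable_fun setT F ->
  mu.-integrable setT (EFin \o (fun x => F x * rho x)%R) ->
  nu.-integrable setT (EFin \o F).
Proof.
move=> mF /integrableP[_ iF]; apply/integrableP; split.
  exact/measurable_EFinP.
rewrite ge0_integral_density//; last first.
  by apply: measurableT_comp => //; exact/measurable_EFinP.
rewrite (eq_integral (fun x => `|((EFin \o (fun x => F x * rho x)%R)) x|))//.
by move=> x _; rewrite /= normrM EFinM (ger0_norm (rho0 x)).
Qed.

Lemma integral_density (F : T -> R) : measurable_fun setT F ->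
  \int[nu]_x (F x)%:E = \int[mu]_x (F x * rho x)%:E.
Proof.
move=> mF; have mFE : measurable_fun setT (EFin \o F) by exact/measurable_EFinP.
rewrite integralE [RHS]integralE.
have pos : \int[nu]_x ((EFin \o F)^\+ x) =
    \int[mu]_x ((fun x => (F x * rho x)%:E)^\+ x).
  rewrite ge0_integral_density; [|exact: measurable_funepos|exact: funepos_ge0].
  apply: eq_integral => x _; rewrite !funeposE/=.
  by rewrite -!EFin_max -EFinM maxr_pMl// mul0r.
have neg : \int[nu]_x ((EFin \o F)^\- x) =
    \int[mu]_x ((fun x => (F x * rho x)%:E)^\- x).
  rewrite ge0_integral_density; [|exact: measurable_funeneg|exact: funeneg_ge0].
  apply: eq_integral => x _; rewrite !funenegE/=.
  by rewrite -!EFin_max -EFinM maxr_pMl// mul0r mulNr.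
by rewrite [X in X - _]pos [X in _ - X]neg.
Qed.

End change_of_density.

(** * Moments, the parameter and tilted laws *)

Definition exchange (R : realType) (x : R * R) : R * R := (x.2, x.1).

Lemma measurable_exchange (R : realType) : measurable_fun setT (@exchange R).
Proof. exact: measurable_fun_pair. Qed.

HB.instance Definition _ (R : realType) :=
  isMeasurableFun.Build _ _ _ _ (@exchange R) (@measurable_exchange R).

HB.instance Definition _ d (T : measurableType d) :=
  isMeasurableFun.Build _ _ _ _ (@idfun T) (@measurable_id _ T setT).

Section moments.
Context d (T : measurableType d) (R : realType).
Implicit Type P : probability T R.

Lemma fine_expectation P (F : T -> R) : fine 'E_P[F]%E = \int[P]_w F w.
Proof. by rewrite unlock. Qed.

Lemma fine_covariance P (F G : T -> R) : fine (covariance P F G) =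
  \int[P]_w ((F w - \int[P]_u F u) * (G w - \int[P]_u G u)).
Proof. by rewrite unlock fine_expectation !fine_expectation. Qed.

Lemma Lfun2_Lfun1 P (F : T -> R) : F \in Lfun P 2%:E -> F \in Lfun P 1%E.
Proof. by move=> F2; apply: (Lfun_subset12 (fin_num_measure P _ measurableT)). Qed.

Lemma fine_covariance_centred P (F G : T -> R) (m n : R) :
  F \in Lfun P 2%:E -> G \in Lfun P 2%:E ->
  fine (covariance P F G) =
  \int[P]_w ((F w - m) * (G w - n)) -
  (\int[P]_w (F w - m)) * (\int[P]_w (G w - n)).
Proof.
move=> F2 G2; rewrite fine_covariance.
have cst2 k : cst k \in Lfun P 2%:E by exact: Lfun_cst.
have B2 (H : T -> R) k : H \in Lfun P 2%:E -> (fun w => H w - k) \in Lfun P 2%:E.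
  by move=> H2; apply: (rpredB H2 (cst2 k)); rewrite lee1n.
have i1 (H : T -> R) : H \in Lfun P 2%:E -> P.-integrable setT (EFin \o H).
  by move=> /Lfun2_Lfun1/Lfun1_integrable.
have icst k : P.-integrable setT (EFin \o (cst k : T -> R)).
  exact: finite_measure_integrable_cst.
have Ecst k : \int[P]_w k = k :> R.
  by rewrite Rintegral_cst// [X in fine X]probability_setT mulr1.
have EB (H : T -> R) k : H \in Lfun P 2%:E ->
    \int[P]_w (H w - k) = \int[P]_w H w - k.
  by move=> H2; rewrite (RintegralB measurableT (i1 _ H2) (icst k)) Ecst.
set mF := \int[P]_w F w; set mG := \int[P]_w G w.
have iFG : P.-integrable setT (EFin \o (fun w => (F w - m) * (G w - n))).
  by apply/Lfun1_integrable; exact: Lfun2_mul_Lfun1 (B2 _ m F2) (B2 _ n G2).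
have E w : (F w - mF) * (G w - mG) = (F w - m) * (G w - n) +
    (- (mG - n) * (F w - m) + (- (mF - m) * (G w - n) + (mF - m) * (mG - n))).
  by ring.
under eq_Rintegral do rewrite E.
have iF := i1 _ (B2 _ m F2); have iG := i1 _ (B2 _ n G2).
have jF := integrableZl measurableT (- (mG - n)) iF.
have jG := integrableZl measurableT (- (mF - m)) iG.
have jc := icst ((mF - m) * (mG - n)).
have jGc := integrableD measurableT jG jc.
rewrite (RintegralD measurableT iFG (integrableD measurableT jF jGc)).
rewrite (RintegralD measurableT jF jGc) (RintegralD measurableT jG jc).
rewrite (RintegralZl _ measurableT iF) (RintegralZl _ measurableT iG) Ecst.
by rewrite !EB// -/mF -/mG; ring.
Qed.

End moments.

(** The parameter does not depend on the constant [m] used for centring. Under a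
    tilted law one centres at the mean of the original law, which turns [psi]
    into a rational function of the tilting parameter. *)
Lemma psi_centred (R : realType) (Q : probability (R * R)%type R) (m : R) :
  (fst : R * R -> R) \in Lfun Q 2%:E -> (snd : R * R -> R) \in Lfun Q 2%:E ->
  psi Q =
  (\int[Q]_x ((x.1 - m) * (x.2 - m)) -
   (\int[Q]_x (x.1 - m)) * (\int[Q]_x (x.2 - m))) /
  (\int[Q]_x ((x.1 - m) * (x.1 - m)) -
   (\int[Q]_x (x.1 - m)) * (\int[Q]_x (x.1 - m))).
Proof.
move=> f2 s2; rewrite /psi (fine_covariance_centred m m f2 s2).
by rewrite (fine_covariance_centred m m f2 f2).
Qed.

Section symmetric_integrals.
Context (R : realType) (Q : probability (R * R)%type R).
Hypothesis Qsym : forall A, measurable A ->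
  Q ((fun x : R * R => (x.2, x.1)) @^-1` A) = Q A.

Let same_law_swap : same_law Q (@exchange R) (@idfun (R * R)%type).
Proof. by move=> A mA; exact: Qsym. Qed.

Lemma Rintegral_swap (F : R * R -> R) : measurable_fun setT F ->
  \int[Q]_x F (x.2, x.1) = \int[Q]_x F x.
Proof. by move=> mF; exact: (same_law_Rintegral same_law_swap mF). Qed.

Lemma integrable_swap (F : R * R -> R) : measurable_fun setT F ->
  Q.-integrable setT (EFin \o F) ->
  Q.-integrable setT (EFin \o (fun x => F (x.2, x.1))).
Proof. by move=> mF; exact: (same_law_integrable same_law_swap mF). Qed.

End symmetric_integrals.

Section tilting.
Context (R : realType) (Q : probability (R * R)%type R).
Variables (g : {mfun (R * R)%type >-> R}) (M t : R).
Hypotheses (gM : forall x, `|g x| <= M) (tM : `|t| * M < 1)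
  (Eg : ('E_Q[g] = 0)%E).

Let dens x := 1 + t * g x.

Let mdens : measurable_fun setT dens.
Proof. by apply: measurable_funD => //; exact: measurable_funM. Qed.

Let dens_ge0 x : 0 <= dens x.
Proof.
rewrite /dens -lerBlDl sub0r lerNl; apply: le_trans (ltW tM).
apply: le_trans (ler_norm _) _; rewrite normrN normrM.
by apply: ler_wpM2l.
Qed.

Let tilt_density A : measurable A ->
  (tilt Q g t A = \int[Q]_(x in A) (dens x)%:E)%E.
Proof. by move=> mA; exact: (tiltE A gM tM Eg). Qed.

Lemma integrable_bounded_mul (F : R * R -> R) :
  Q.-integrable setT (EFin \o F) ->
  Q.-integrable setT (EFin \o (fun x => F x * g x)).
Proof.
move=> iF; have mF : measurable_fun setT F.
  by apply/measurable_EFinP; exact: measurable_int iF.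
apply: (@le_integrable _ _ _ Q _ measurableT _ (fun x => M%:E * (F x)%:E)%E).
- by apply/measurable_EFinP; exact: measurable_funM.
- move=> x _; rewrite /= lee_fin normrM [leRHS]normrM mulrC.
  by rewrite ler_wpM2r// (le_trans (gM x))// ler_norm.
- exact: integrableZl.
Qed.

Let idens (F : R * R -> R) : Q.-integrable setT (EFin \o F) ->
  Q.-integrable setT (EFin \o (fun x => F x * dens x)).
Proof.
move=> iF.
have -> : (fun x => F x * dens x) = (fun x => F x + t * (F x * g x)).
  by apply/funext => x; rewrite /dens; ring.
exact: (integrableD measurableT iF
  (integrableZl measurableT t (integrable_bounded_mul iF))).
Qed.

Lemma integrable_tilt (F : R * R -> R) :
  Q.-integrable setT (EFin \o F) -> (tilt Q g t).-integrable setT (EFin \o F).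
Proof.
move=> iF; apply: (integrable_density mdens dens_ge0 tilt_density).
  by apply/measurable_EFinP; exact: measurable_int iF.
exact: idens.
Qed.

Lemma Rintegral_tilt (F : R * R -> R) : Q.-integrable setT (EFin \o F) ->
  \int[tilt Q g t]_x F x = \int[Q]_x F x + t * \int[Q]_x (F x * g x).
Proof.
move=> iF; have mF : measurable_fun setT F.
  by apply/measurable_EFinP; exact: measurable_int iF.
rewrite /Rintegral (integral_density mdens dens_ge0 tilt_density mF).
have igF := integrable_bounded_mul iF.
transitivity (\int[Q]_x (F x + t * (F x * g x))).
  by apply: eq_Rintegral => x _; rewrite /dens; ring.
rewrite (RintegralD measurableT iF (integrableZl measurableT t igF)).
by rewrite (RintegralZl _ measurableT igF).
Qed.

End tilting.

(** * Approximation by bounded symmetric functions *)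

Lemma Lnorm2_lt d (T : measurableType d) (R : realType)
    (mu : {measure set T -> \bar R}) (F : T -> R) (e : R) : 0 < e ->
  mu.-integrable setT (EFin \o (fun x => F x ^+ 2)) ->
  \int[mu]_x (F x ^+ 2) < e ^+ 2 -> ('N[mu]_2%:E[EFin \o F] < e%:E)%E.
Proof.
move=> e0 iF Fe; rewrite ltNge; apply/negP => eN.
have h : (e%:E `^ 2 <= 'N[mu]_2%:E[EFin \o F] `^ 2)%E.
  apply: gt0_ler_poweR => //; rewrite in_itv/= leey andbT.
    by rewrite lee_fin ltW.
  exact: Lnorm_ge0.
move: h; rewrite powR_Lnorm ?pnatr_eq0// poweR_EFin powR_mulrn; last exact: ltW.
rewrite (eq_integral (fun x => (F x ^+ 2)%:E)); last first.
  by move=> x _ /=; rewrite ?poweR_EFin powR_mulrn// real_normK// num_real.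
rewrite -(fineK (integrable_fin_num measurableT iF)) lee_fin leNgt.
by rewrite Fe.
Qed.

Section truncation.
Context (R : realType) (Q : probability (R * R)%type R).
Variable h : {mfun (R * R)%type >-> R}.
Hypothesis h2 : (h : R * R -> R) \in Lfun Q 2%:E.

Definition truncation (n : nat) (x : R * R) : R :=
  if `|h x| <= n%:R then h x else 0.

Lemma measurable_truncation n : measurable_fun setT (truncation n).
Proof.
apply: measurable_fun_ifT => //.
by apply: measurable_fun_ler => //; exact: measurableT_comp.
Qed.

Lemma truncation_bounded n x : `|truncation n x| <= n%:R.
Proof. by rewrite /truncation; case: ifPn => // _; rewrite normr0. Qed.

Let k n x := h x - truncation n x.

Let mk n : measurable_fun setT (k n).
Proof. by apply: measurable_funB => //; exact: measurable_truncation. Qed.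

Let k_le n x : k n x ^+ 2 <= h x ^+ 2.
Proof.
rewrite /k /truncation; case: ifPn => _; last by rewrite subr0.
by rewrite subrr expr0n/= sqr_ge0.
Qed.

Let ih2 : Q.-integrable setT (EFin \o (fun x => h x ^+ 2)).
Proof. exact: Lfun2_integrable_sqr. Qed.

Lemma integrable_truncation_error n :
  Q.-integrable setT (EFin \o (fun x => (h x - truncation n x) ^+ 2)).
Proof.
apply: le_integrable ih2 => //.
  by apply/measurable_EFinP; exact: (measurable_funX 2 (mk n)).
by move=> x _ /=; rewrite lee_fin !ger0_norm ?sqr_ge0//; exact: k_le.
Qed.

Lemma truncation_error_cvg0 :
  \int[Q]_x ((h x - truncation n x) ^+ 2) @[n --> \oo] --> (0 : R).
Proof.
pose k2 n x := (k n x ^+ 2)%:E.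
have cvgk : {ae Q, forall x, setT x -> k2 n x @[n --> \oo] --> 0%E}.
  apply: aeW => x _; apply: cvg_near_cst; near=> n.
  rewrite /k2 /k /truncation ifT ?subrr ?expr0n//.
  by near: n; exact: nbhs_infty_ger.
have lek : {ae Q, forall x n, setT x -> (`|k2 n x| <= (h x ^+ 2)%:E)%E}.
  by apply: aeW => x n _; rewrite /= lee_fin ger0_norm ?sqr_ge0//; exact: k_le.
have [_ _ lim] := dominated_convergence measurableT
  (fun n => measurable_int _ (integrable_truncation_error n))
  (measurable_cst _) cvgk ih2 lek.
by move: lim; rewrite integral0 => /fine_cvg; exact.
Unshelve. all: by end_near. Qed.

Hypothesis hsym : forall x y, h (x, y) = h (y, x).
Hypothesis Eh : \int[Q]_x h x = 0.

(** The truncations of a symmetric centred [h] are symmetric and bounded, and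
    converge to [h] in L2 by dominated convergence.  Recentring them does not
    increase the distance to [h], as a variance is at most the corresponding
    second moment. *)
Lemma symmetric_in_closure : in_L2_closure Q (tangent_set Q) h.
Proof.
split=> // e e0.
have e20 : 0 < e ^+ 2 by exact: exprn_gt0.
have [n kn] : exists n, \int[Q]_x (k n x ^+ 2) < e ^+ 2.
  move/cvgrPdist_lt : truncation_error_cvg0 => /(_ _ e20) [n _ /(_ n (leqnn n))].
  rewrite /= sub0r normrN => H; exists n.
  exact: le_lt_trans (ler_norm _) H.
pose c := \int[Q]_x truncation n x.
have mg : measurable_fun setT (fun x => truncation n x - c).
  by apply: measurable_funB => //; exact: measurable_truncation.
pose g : {mfun (R * R)%type >-> R} := mfun_Sub (mem_set mg).
have icst r : Q.-integrable setT (EFin \o (cst r : R * R -> R)).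
  exact: finite_measure_integrable_cst.
have Ecst r : \int[Q]_x r = r :> R.
  by rewrite Rintegral_cst// [X in fine X]probability_setT mulr1.
have ih : Q.-integrable setT (EFin \o h).
  exact/Lfun1_integrable/Lfun2_Lfun1.
have it : Q.-integrable setT (EFin \o truncation n).
  apply: le_integrable (icst n%:R) => //.
    by apply/measurable_EFinP; exact: measurable_truncation.
  move=> x _ /=; rewrite lee_fin (le_trans (truncation_bounded _ _))//.
  by rewrite ler_norm.
exists g.
  split.
  - exists (n%:R + `|c|) => x; rewrite /g/=.
    by apply: (le_trans (ler_normB _ _)); rewrite lerD2r; exact: truncation_bounded.
  - by move=> x y; rewrite /g/= /truncation hsym.
  - have fin : ('E_Q[g] \is a fin_num)%E.
      rewrite unlock; apply: integrable_fin_num => //.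
      exact: (integrableB measurableT it (icst c)).
    rewrite -(fineK fin) fine_expectation.
    have -> : \int[Q]_x g x = \int[Q]_x (truncation n x - c) by [].
    by rewrite (RintegralB measurableT it (icst c)) Ecst subrr.
have ik2 := integrable_truncation_error n.
have ik : Q.-integrable setT (EFin \o k n) := integrableB measurableT ih it.
have Ek : \int[Q]_x k n x = - c.
  by rewrite (RintegralB measurableT ih it) Eh sub0r.
have kcE x : (h x - g x) ^+ 2 = k n x ^+ 2 + ((2 * c) * k n x + c ^+ 2).
  by rewrite /g /= /k; ring.
have i1 := integrableZl measurableT (2 * c) ik.
have i2 := integrableD measurableT i1 (icst (c ^+ 2)).
apply: Lnorm2_lt => //.
  rewrite (_ : (fun x => _) = (fun x => k n x ^+ 2 + ((2 * c) * k n x + c ^+ 2))).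
    exact: (integrableD measurableT ik2 i2).
  by apply/funext => x; exact: kcE.
apply: le_lt_trans kn.
have -> : \int[Q]_x ((h \- g) x ^+ 2) =
    \int[Q]_x (k n x ^+ 2 + ((2 * c) * k n x + c ^+ 2)).
  by apply: eq_Rintegral => x _; exact: kcE.
rewrite (RintegralD measurableT ik2 i2) (RintegralD measurableT i1 (icst _)).
rewrite (RintegralZl _ measurableT ik) Ek Ecst.
by rewrite gerDl; have := sqr_ge0 c; lra.
Qed.

End truncation.

(** * The efficient influence function *)

Section influence.
Context (R : realType) (Q : probability (R * R)%type R).

Local Notation mu := (\int[Q]_x x.1).
Local Notation v := (fine 'V_Q[fst]%E).

(** The derivative at [Q] of the covariance is the function
    [(x.1 - mu) * (x.2 - mu)] up to a constant, that of the variance is the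
    symmetrised square up to a constant, and this is the derivative of their
    ratio.  Symmetrising the square puts it in the closure of the tangent set
    without changing its expectation against a symmetric function. *)
Definition sobol_influence (x : R * R) : R :=
  ((x.1 - mu) * (x.2 - mu) -
   psi Q * (((x.1 - mu) ^+ 2 + (x.2 - mu) ^+ 2) / 2)) / v.

Let m1 : measurable_fun setT (fun x : R * R => x.1 - mu).
Proof. exact: measurable_funB. Qed.
Let m2 : measurable_fun setT (fun x : R * R => x.2 - mu).
Proof. exact: measurable_funB. Qed.

Lemma measurable_sobol_influence : measurable_fun setT sobol_influence.
Proof.
apply: measurable_funM => //; apply: measurable_funB.
  exact: measurable_funM.
apply: measurable_funM => //; apply: measurable_funM => //.
by apply: measurable_funD; exact: measurable_funX.
Qed.

HB.instance Definition _ := isMeasurableFun.Build _ _ _ _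
  sobol_influence measurable_sobol_influence.

Hypothesis Qsym : forall A, measurable A ->
  Q ((fun x : R * R => (x.2, x.1)) @^-1` A) = Q A.
Hypothesis Q4 : (fun x : R * R => (x.1 - mu) ^+ 2) \in Lfun Q 2%:E.
Hypothesis Qv : ('V_Q[fst] != 0)%E.

Let int (F : R * R -> R) := Q.-integrable setT (EFin \o F).
Let E (F : R * R -> R) := \int[Q]_x F x.

Let intD F G : int F -> int G -> int (fun x => F x + G x).
Proof. by move=> iF iG; exact: (integrableD measurableT iF iG). Qed.

Let intZ k F : int F -> int (fun x => k * F x).
Proof. by move=> iF; exact: (integrableZl measurableT k iF). Qed.

Let int_cst k : int (fun=> k).
Proof. exact: finite_measure_integrable_cst. Qed.

Let int_le (F G : R * R -> R) : measurable_fun setT F ->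
  (forall x, `|F x| <= G x) -> int G -> int F.
Proof.
move=> mF FG iG; apply: le_integrable iG => //; first exact/measurable_EFinP.
by move=> w _ /=; rewrite lee_fin (le_trans (FG _))// ler_norm.
Qed.

Let E_D F G : int F -> int G -> E (fun x => F x + G x) = E F + E G.
Proof. by move=> iF iG; exact: (RintegralD measurableT iF iG). Qed.

Let E_Z k F : int F -> E (fun x => k * F x) = k * E F.
Proof. by move=> iF; exact: (RintegralZl k measurableT iF). Qed.

Let E_cst k : E (fun=> k) = k.
Proof. by rewrite /E Rintegral_cst// [X in fine X]probability_setT mulr1. Qed.

Let a (x : R * R) := x.1 - mu.
Let b (x : R * R) := x.2 - mu.

Let ia4 : int (fun x => (a x ^+ 2) ^+ 2).
Proof. exact: Lfun2_integrable_sqr Q4. Qed.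

Let ib4 : int (fun x => (b x ^+ 2) ^+ 2).
Proof.
apply: (integrable_swap Qsym (F := fun x => (a x ^+ 2) ^+ 2)) => //.
by do 2 apply: measurable_funX.
Qed.

Let ia2 : int (fun x => a x ^+ 2).
Proof. exact/Lfun1_integrable/Lfun2_Lfun1. Qed.

Let ib2 : int (fun x => b x ^+ 2).
Proof.
apply: (integrable_swap Qsym (F := fun x => a x ^+ 2)) => //.
exact: measurable_funX.
Qed.

Let a2 : a \in Lfun Q 2%:E. Proof. exact: integrable_sqr_Lfun2. Qed.
Let b2 : b \in Lfun Q 2%:E. Proof. exact: integrable_sqr_Lfun2. Qed.

Lemma fst_Lfun2 : (fst : R * R -> R) \in Lfun Q 2%:E.
Proof.
have -> : (fst : R * R -> R) = (a + cst mu)%R.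
  by apply/funext => x; rewrite fctE/= subrK.
by apply: (rpredD a2 (Lfun_cst _ mu _)); rewrite lee1n.
Qed.

Lemma snd_Lfun2 : (snd : R * R -> R) \in Lfun Q 2%:E.
Proof.
have -> : (snd : R * R -> R) = (b + cst mu)%R.
  by apply/funext => x; rewrite fctE/= subrK.
by apply: (rpredD b2 (Lfun_cst _ mu _)); rewrite lee1n.
Qed.

Lemma exchangeable_in_model : exchangeable_model Q.
Proof. by split; [exact: fst_Lfun2|exact: snd_Lfun2|exact: Qsym]. Qed.

Let ia : int a. Proof. exact/Lfun1_integrable/Lfun2_Lfun1. Qed.
Let ib : int b. Proof. exact/Lfun1_integrable/Lfun2_Lfun1. Qed.
Let iab : int (fun x => a x * b x).
Proof. by apply/Lfun1_integrable; exact: Lfun2_mul_Lfun1. Qed.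

Lemma fst_centred : \int[Q]_x (x.1 - mu) = 0.
Proof.
have i1 : int fst by exact/Lfun1_integrable/Lfun2_Lfun1/fst_Lfun2.
by rewrite [LHS]E_D// E_cst subrr.
Qed.

Lemma snd_centred : \int[Q]_x (x.2 - mu) = 0.
Proof. by rewrite -fst_centred; exact: (Rintegral_swap Qsym (F := a)). Qed.

Let va : v = E (fun x => a x ^+ 2).
Proof. by rewrite /variance fine_covariance. Qed.

Let vb : E (fun x => b x ^+ 2) = v.
Proof.
rewrite va; apply: (Rintegral_swap Qsym (F := fun x => a x ^+ 2)).
exact: measurable_funX.
Qed.

Lemma variance_fst_gt0 : 0 < v.
Proof.
rewrite lt_neqAle fine_ge0 ?variance_ge0// andbT eq_sym.
by rewrite fine_eq0// variance_fin_num// fst_Lfun2.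
Qed.

Let vN0 : v != 0. Proof. by rewrite gt_eqF// variance_fst_gt0. Qed.

Lemma psi_covariance :
  \int[Q]_x ((x.1 - mu) * (x.2 - mu)) = psi Q * v.
Proof.
rewrite /psi mulfVK// fine_covariance.
have -> : \int[Q]_u u.2 = mu by exact: (Rintegral_swap Qsym (F := fst)).
by [].
Qed.

Let half x := (a x ^+ 2 + b x ^+ 2) / 2.

Let halfE : half = (fun x => 2^-1 * (a x ^+ 2 + b x ^+ 2)).
Proof. by apply/funext => x; rewrite /half mulrC. Qed.

Let ihalf : int half. Proof. by rewrite halfE; apply: intZ; exact: intD. Qed.

Lemma half_sum_squares :
  \int[Q]_x (((x.1 - mu) ^+ 2 + (x.2 - mu) ^+ 2) / 2) = v.
Proof. by rewrite -[LHS]/(E half) halfE E_Z ?E_D// -?va ?vb; [field|exact: intD]. Qed.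

Let hE : sobol_influence = (fun x => v^-1 * (a x * b x + (- psi Q) * half x)).
Proof. by apply/funext => x; rewrite /sobol_influence /half -/(a x) -/(b x); ring. Qed.

Let ih : int sobol_influence.
Proof. by rewrite hE; apply: intZ; apply: intD => //; exact: intZ. Qed.

Lemma sobol_influence_centred : \int[Q]_x sobol_influence x = 0.
Proof.
rewrite hE [LHS]E_Z; last by apply: intD => //; exact: intZ.
rewrite E_D//; last exact: intZ.
by rewrite E_Z// [E _]psi_covariance [E half]half_sum_squares; ring.
Qed.

Lemma sobol_influence_Lfun2 : (sobol_influence : R * R -> R) \in Lfun Q 2%:E.
Proof.
apply: integrable_sqr_Lfun2; first exact: measurable_sobol_influence.
pose K := v^-1 ^+ 2 * (1 + psi Q ^+ 2).
have iK : int (fun x => K * ((a x ^+ 2) ^+ 2 + (b x ^+ 2) ^+ 2)).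
  by apply: intZ; exact: intD.
apply: int_le iK.
  by apply: measurable_funX; exact: measurable_sobol_influence.
move=> x; rewrite ger0_norm ?sqr_ge0// hE exprMn /K -mulrA.
rewrite ler_wpM2l ?sqr_ge0// /half.
have h1 : (a x * b x + - psi Q * ((a x ^+ 2 + b x ^+ 2) / 2)) ^+ 2 <=
    (1 + psi Q ^+ 2) * ((a x * b x) ^+ 2 + ((a x ^+ 2 + b x ^+ 2) / 2) ^+ 2).
  have := sqr_ge0 (psi Q * (a x * b x) + ((a x ^+ 2 + b x ^+ 2) / 2)).
  lra.
apply: (le_trans h1); rewrite ler_wpM2l ?addr_ge0 ?sqr_ge0// exprMn.
have := sqr_ge0 (a x ^+ 2 - b x ^+ 2).
have := sqr_ge0 (a x ^+ 2); have := sqr_ge0 (b x ^+ 2); lra.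
Qed.

Lemma sobol_influence_sym x y : sobol_influence (x, y) = sobol_influence (y, x).
Proof. by rewrite /sobol_influence/=; ring. Qed.

Section pathwise_derivative.
Variables (g : {mfun (R * R)%type >-> R}) (M : R).
Hypotheses (gM : forall x, `|g x| <= M) (gsym : forall x y, g (x, y) = g (y, x))
  (Eg : ('E_Q[g] = 0)%E).

Let k12 := E (fun x => a x * b x * g x).
Let k11 := E (fun x => a x * a x * g x).
Let e1 := E (fun x => a x * g x).
Let e2 := E (fun x => b x * g x).

Let iaa : int (fun x => a x * a x). Proof. exact: ia2. Qed.

Let psi_tilt t : `|t| * M < 1 -> psi (tilt Q g t) =
  (psi Q * v + t * k12 - t * e1 * (t * e2)) /
  (v + t * k11 - t * e1 * (t * e1)).
Proof.
move=> tM; have itilt F := @integrable_tilt _ _ _ _ _ gM tM Eg F.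
have Etilt F := @Rintegral_tilt _ _ _ _ _ gM tM Eg F.
have L2 (F : R * R -> R) : measurable_fun setT F -> int (fun x => F x ^+ 2) ->
    F \in Lfun (tilt Q g t) 2%:E.
  by move=> mF iF; apply: integrable_sqr_Lfun2 => //; exact: itilt.
rewrite (psi_centred mu).
- rewrite (Etilt _ iab) (Etilt _ ia) (Etilt _ ib) (Etilt _ iaa).
  rewrite -/k12 -/k11 -/e1 -/e2 [\int[Q]_x a x]fst_centred.
  rewrite [\int[Q]_x b x]snd_centred !add0r.
  by rewrite [\int[Q]_x (a x * b x)]psi_covariance [\int[Q]_x (a x * a x)](esym va).
- by apply: L2 => //; apply: Lfun2_integrable_sqr; exact: fst_Lfun2.
- by apply: L2 => //; apply: Lfun2_integrable_sqr; exact: snd_Lfun2.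
Qed.

Let Ehg : E (fun x => sobol_influence x * g x) = (k12 - psi Q * k11) / v.
Proof.
have iabg := integrable_bounded_mul gM iab.
have iaag := integrable_bounded_mul gM iaa.
have ibbg : int (fun x => b x * b x * g x) := integrable_bounded_mul gM ib2.
have k22 : E (fun x => b x * b x * g x) = k11.
  transitivity (\int[Q]_x (a (x.2, x.1) * a (x.2, x.1) * g (x.2, x.1))).
    by apply: eq_Rintegral => -[x y] _ /=; rewrite gsym.
  apply: (Rintegral_swap Qsym (F := fun x => a x * a x * g x)).
  by apply: measurable_funM => //; exact: measurable_funM.
have -> : (fun x => sobol_influence x * g x) = (fun x => v^-1 *
    (a x * b x * g x + - (psi Q / 2) * (a x * a x * g x + b x * b x * g x))).
  by apply/funext => x; rewrite hE /half; ring.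
have i1 := intD iaag ibbg; have i2 := intZ (- (psi Q / 2)) i1.
rewrite E_Z; last exact: (intD iabg i2).
by rewrite (E_D iabg i2) (E_Z _ i1) (E_D iaag ibbg) k22 -/k12 -/k11; field.
Qed.

(** The difference quotient is a rational function of [t], continuous at 0;
    symmetry of [g] makes the two coordinates contribute equally to its value. *)
Lemma psi_pathwise_derivative :
  (psi (tilt Q g t) - psi Q) / t @[t --> 0^'] -->
  fine ('E_Q[(sobol_influence \* g)%R])%E.
Proof.
rewrite fine_expectation [X in _ --> X]Ehg.
have ct : t @[t --> (0 : R)^'] --> (0 : R) by move=> A; exact: nbhs_dnbhs.
pose den t := v + t * k11 - t * e1 * (t * e1).
have cden : den t @[t --> (0 : R)^'] --> v.
  have -> : v = v + 0 * k11 - 0 * e1 * (0 * e1) by ring.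
  apply: cvgB.
    by apply: cvgD; [exact: cvg_cst|apply: cvgM => //; exact: cvg_cst].
  by apply: cvgM; apply: cvgM => //; exact: cvg_cst.
pose phi t := (k12 - psi Q * k11 - t * (e1 * e2 - psi Q * e1 ^+ 2)) / den t.
have cphi : phi t @[t --> (0 : R)^'] --> (k12 - psi Q * k11) / v.
  apply: cvgM; last by apply: cvgV => //; exact: vN0.
  rewrite -[X in _ --> X]subr0; apply: cvgB; first exact: cvg_cst.
  rewrite -[X in _ --> X](mul0r (e1 * e2 - psi Q * e1 ^+ 2)).
  by apply: cvgM => //; exact: cvg_cst.
have M0 : 0 <= M by exact: le_trans (normr_ge0 _) (gM (0, 0)).
apply: cvg_trans cphi; apply: near_eq_cvg; near=> t.
have t0 : t != 0 by near: t; exact: nbhs_dnbhs_neq.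
have tM : `|t| * M < 1.
  have : `|0 - t| < (M + 1)^-1.
    near: t; move/cvgrPdist_lt : ct; apply.
    by rewrite invr_gt0 ltr_wpDl.
  rewrite sub0r normrN -[(M + 1)^-1]mul1r ltr_pdivlMr ?ltr_wpDl//.
  by apply: le_lt_trans; rewrite ler_wpM2l// lerDl.
have d0 : den t != 0 by near: t; apply: cvgr_neq0 cden _; exact: vN0.
rewrite psi_tilt// /phi -/(den t).
have -> : psi Q * v + t * k12 - t * e1 * (t * e2) = psi Q * den t +
    t * (k12 - psi Q * k11 - t * (e1 * e2 - psi Q * e1 ^+ 2)).
  by rewrite /den; ring.
move: d0; set D := den t => d0.
by field; rewrite t0 d0.
Unshelve. all: by end_near. Qed.

End pathwise_derivative.

Lemma sobol_influence_efficient :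
  is_efficient_influence_function Q sobol_influence.
Proof.
split.
  apply: symmetric_in_closure; first exact: sobol_influence_Lfun2.
    exact: sobol_influence_sym.
  exact: sobol_influence_centred.
by move=> g [[M gM] gsym Eg]; exact: (psi_pathwise_derivative gM gsym Eg).
Qed.

End influence.

(** * Conditional expectations *)

Section conditional_expectation.
Context d (T : measurableType d) (R : realType) (P : probability T R).
Context d' (U : measurableType d') (X : {mfun T >-> U}).

Lemma sigma_of_measurable A : sigma_of X A -> measurable A.
Proof. by move=> [B mB <-]; exact: measurable_funP. Qed.

Let sub_sigma (F : T -> R) :
  preimage_set_system setT F measurable `<=` sigma_of X ->
  measurable_fun (setT : set (g_sigma_algebra_preimageType X)) F.
Proof. by move=> FX _ B mB; apply: FX; exists B. Qed.

(** The difference of two versions is nonnegative on a conditioning event and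
    negative on its complement, and it integrates to 0 over both. *)
Lemma cond_exp_unique (Y m m' : T -> R) :
  is_cond_exp P (sigma_of X) Y m -> is_cond_exp P (sigma_of X) Y m' ->
  m = m' %[ae P].
Proof.
move=> [mX m1 mE] [m'X m'1 m'E].
have im : P.-integrable setT (EFin \o m) by exact/Lfun1_integrable.
have im' : P.-integrable setT (EFin \o m') by exact/Lfun1_integrable.
pose D x := m x - m' x.
have iD : P.-integrable setT (EFin \o D) by exact: (integrableB measurableT im im').
have mD : measurable_fun setT D by apply/measurable_EFinP; exact: measurable_int iD.
have int0 A : sigma_of X A -> (\int[P]_(x in A) (D x)%:E = 0)%E.
  move=> XA; have mA := sigma_of_measurable XA.
  have imA := integrableS measurableT mA (@subsetT _ A) im.
  have im'A := integrableS measurableT mA (@subsetT _ A) im'.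
  rewrite (integralB_EFin mA imA im'A) mE// m'E// subee//.
  by rewrite -m'E//; exact: integrable_fin_num.
pose A := [set x | 0 <= D x].
have XA : sigma_of X A.
  have mDX : measurable_fun (setT : set (g_sigma_algebra_preimageType X)) D.
    by apply: measurable_funB; exact: sub_sigma.
  have := mDX measurableT `[0, +oo[%classic (measurable_itv _).
  rewrite setTI; congr (measurable _).
  by apply/seteqP; split=> x; rewrite /A /preimage/= in_itv/= andbT.
have mA := sigma_of_measurable XA.
have XAC : sigma_of X (~` A).
  by case: XA => B mB <-; exists (~` B); [exact: measurableC|
    rewrite !setTI preimage_setC].
have iN : (\int[P]_x `|(D x)%:E| = 0)%E.
  rewrite -(setUv A) ge0_integral_setU//=; last 3 first.
  - exact: measurableC.
  - by rewrite setUv; do 2 apply: measurableT_comp => //.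
  - exact/disj_setPCl.
  have e1 : (\int[P]_(x in A) `|D x|%:E = \int[P]_(x in A) (D x)%:E)%E.
    by apply: eq_integral => x; rewrite inE => Dx; rewrite ger0_norm.
  have e2 : (\int[P]_(x in ~` A) `|D x|%:E =
      \int[P]_(x in ~` A) (- (D x)%:E))%E.
    apply: eq_integral => x; rewrite inE => /negP; rewrite -ltNge => Dx.
    by rewrite ltr0_norm.
  rewrite e1 e2 int0// add0e.
  have mAC := measurableC mA.
  have iDC := integrableS measurableT mAC (@subsetT _ _) iD.
  rewrite (@integralN _ _ _ _ _ (EFin \o D)); first by rewrite int0// oppe0.
  exact: integrable_add_def.
have mDE : measurable_fun setT (EFin \o D) by exact/measurable_EFinP.
have := proj1 (ae_eq_integral_abs P measurableT mDE) iN.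
apply: filterS => x /= /(_ Logic.I) [] /eqP; rewrite subr_eq0 => /eqP mm'.
by move=> _.
Qed.

Lemma cond_expP (Y m : T -> R) : is_cond_exp P (sigma_of X) Y m ->
  is_cond_exp P (sigma_of X) Y (cond_exp P Y X).
Proof.
by move=> h; apply: (@getPex _ [set m | is_cond_exp P (sigma_of X) Y m]); exists m.
Qed.

Lemma variance_cond_exp (Y m : T -> R) : is_cond_exp P (sigma_of X) Y m ->
  fine 'V_P[cond_exp P Y X]%E = fine 'V_P[m]%E.
Proof.
move=> h; have h' := cond_expP h.
have ae := cond_exp_unique h' h.
have [_ m1 _] := h; have [_ c1 _] := h'.
have mm : measurable_fun setT m.
  by apply/measurable_EFinP; apply: measurable_int (proj1 (Lfun1_integrable P m) m1).
have mc : measurable_fun setT (cond_exp P Y X).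
  apply/measurable_EFinP.
  by apply: measurable_int (proj1 (Lfun1_integrable P (cond_exp P Y X)) c1).
rewrite /variance !fine_covariance.
have aeint (G : R -> R) : measurable_fun setT G ->
    \int[P]_w G (cond_exp P Y X w) = \int[P]_w G (m w).
  move=> mG; congr fine; apply: ae_eq_integral => //.
  - by apply/measurable_EFinP; exact: measurableT_comp.
  - by apply/measurable_EFinP; exact: measurableT_comp.
  - by apply: filterS ae => w /= H /H ->.
rewrite (aeint id)//; set k := \int[P]_w m w.
apply: (aeint (fun r => (r - k) * (r - k))).
by apply: measurable_funM; exact: measurable_funB.
Qed.

End conditional_expectation.

(** * Two outputs sharing one input *)

Section pick_freeze.
Context d (T : measurableType d) (R : realType) (P : probability T R).
Context d1 d2 (U : measurableType d1) (V : measurableType d2).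
Variables (X : {mfun T >-> U}) (Z Z' : {mfun T >-> V})
  (f : {mfun (U * V)%type >-> R}).
Hypothesis indep : forall A B C, measurable A -> measurable B -> measurable C ->
  P (X @^-1` A `&` Z @^-1` B `&` Z' @^-1` C) =
  (P (X @^-1` A) * P (Z @^-1` B) * P (Z' @^-1` C))%E.
Hypothesis lawZ : same_law P Z' Z.

Let Y := output f X Z.
Let Y' := output f X Z'.


Let indep' A B C : measurable A -> measurable B -> measurable C ->
  P (X @^-1` A `&` Z' @^-1` B `&` Z @^-1` C) =
  (P (X @^-1` A) * P (Z' @^-1` B) * P (Z @^-1` C))%E.
Proof.
move=> mA mB mC.
have -> : X @^-1` A `&` Z' @^-1` B `&` Z @^-1` C =
    X @^-1` A `&` Z @^-1` C `&` Z' @^-1` B by rewrite -!setIA [X in _ `&` X]setIC.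
by rewrite indep// -!muleA [X in (_ * X)%E]muleC.
Qed.

Lemma exchange_law : same_law P (rv_pair (rv_pair X Z) Z') (rv_pair (rv_pair X Z') Z).
Proof.
apply: independent_triple_same_law => //.
by move=> A mA; rewrite lawZ.
Qed.

(** The marginal of [exchange_law] that forgets the last coordinate. *)
Lemma pick_freeze_law : same_law P (rv_pair X Z') (rv_pair X Z).
Proof.
move=> A mA.
have mAT : measurable (A `*` [set: V]) by exact: measurableX.
have E (F G : {mfun T >-> V}) : P (rv_pair (rv_pair X F) G @^-1` (A `*` setT)) =
    P (rv_pair X F @^-1` A).
  by congr (P _); apply/seteqP; split => w /=; [move=> []|].
by have := exchange_law mAT; rewrite (E Z Z') (E Z' Z) => ->.
Qed.

Lemma exchangeable_outputs A : measurable A ->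
  distribution P (rv_pair Y Y') ((fun x : R * R => (x.2, x.1)) @^-1` A) =
  distribution P (rv_pair Y Y') A.
Proof.
move=> mA.
pose B : set (U * V * V) := [set u | A (f (u.1.1, u.2), f (u.1.1, u.1.2))].
have mB : measurable B.
  have mF : measurable_fun setT (fun u : U * V * V => (f (u.1.1, u.2), f (u.1.1, u.1.2))).
    have m11 : measurable_fun setT (fun u : U * V * V => u.1.1).
      by apply: (measurableT_comp measurable_fst); exact: measurable_fst.
    apply: measurable_fun_pair; apply: measurableT_comp => //.
      by apply: measurable_fun_pair => //; exact: measurable_snd.
    apply: measurable_fun_pair => //.
    by apply: (measurableT_comp measurable_snd); exact: measurable_fst.
  by rewrite -[B]setTI; exact: mF.
exact: exchange_law mB.
Qed.

Let PZ : probability V R := distribution P Z'.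

(** By independence of [X] and [Z'], this function of [X] is [E(Y | X)]. *)
Definition frozen_mean (u : U) : R := fine (\int[PZ]_z (f (u, z))%:E)%E.

Hypothesis Y1 : Y \in Lfun P 1%E.

Let iY : P.-integrable setT (EFin \o Y). Proof. exact/Lfun1_integrable. Qed.

Let mf : measurable_fun setT f. Proof. by []. Qed.

Let iY' : P.-integrable setT (EFin \o Y').
Proof. exact: (same_law_integrable pick_freeze_law mf iY). Qed.

Let PXZ : probability (U * V)%type R := distribution P (rv_pair X Z).

Let mf' : measurable_fun setT (fun u : U * V * V => f (u.1.1, u.2)).
Proof.
apply: measurableT_comp => //; apply: measurable_fun_pair.
  by apply: (measurableT_comp measurable_fst); exact: measurable_fst.
exact: measurable_snd.
Qed.

Let law A : measurable A ->
  distribution P (rv_pair (rv_pair X Z) Z') A = (PXZ \x PZ)%E A.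
Proof. exact: independent_triple_law. Qed.

Let integrable_law (F : U * V * V -> R) : measurable_fun setT F ->
  P.-integrable setT (EFin \o (fun w => F (X w, Z w, Z' w))) ->
  ((PXZ \x PZ)%E).-integrable setT (EFin \o F).
Proof.
move=> mF iF; have mFE : measurable_fun setT (EFin \o F) by exact/measurable_EFinP.
apply/integrableP; split=> //.
rewrite (eq_measure_integral (distribution P (rv_pair (rv_pair X Z) Z'))); last first.
  by move=> A mA _; exact/esym/law.
rewrite ge0_integral_distribution//; last exact: measurableT_comp.
by case/integrableP: iF.
Qed.

Let integral_law (F : U * V * V -> R) : measurable_fun setT F ->
  P.-integrable setT (EFin \o (fun w => F (X w, Z w, Z' w))) ->
  (\int[P]_w (F (X w, Z w, Z' w))%:E = \int[PXZ \x PZ]_u (F u)%:E)%E.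
Proof.
move=> mF iF; have mFE : measurable_fun setT (EFin \o F) by exact/measurable_EFinP.
transitivity (\int[distribution P (rv_pair (rv_pair X Z) Z')]_u (F u)%:E)%E.
  by rewrite integral_distribution.
by apply: eq_measure_integral => A mA _; exact: law.
Qed.

Let iYlaw : ((PXZ \x PZ)%E).-integrable setT
  (EFin \o (fun u : U * V * V => f (u.1.1, u.2))).
Proof. exact: integrable_law. Qed.

Lemma measurable_frozen_mean : measurable_fun setT frozen_mean.
Proof.
have mF := measurable_fubini_F iYlaw.
have mFf : measurable_fun setT
    (fine \o fubini_F PZ (EFin \o (fun u : U * V * V => f (u.1.1, u.2)))).
  by apply: measurableT_comp => //; exact: mF.
exact: (measurableT_comp mFf (measurable_fun_pair (@measurable_id _ U setT) (measurable_cst point))).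
Qed.

(** Since [Z'] is independent of [(X, Z)], it can be integrated out first. *)
Lemma frozen_mean_integral (phi : U * V -> R) : measurable_fun setT phi ->
  P.-integrable setT (EFin \o (fun w => phi (X w, Z w) * Y' w)) ->
  P.-integrable setT (EFin \o (fun w => phi (X w, Z w) * frozen_mean (X w))) /\
  (\int[P]_w (phi (X w, Z w) * Y' w)%:E =
   \int[P]_w (phi (X w, Z w) * frozen_mean (X w))%:E)%E.
Proof.
move=> mphi iphi.
pose F (u : U * V * V) := phi u.1 * f (u.1.1, u.2).
have mF : measurable_fun setT F.
  apply: measurable_funM => //.
  by apply: (measurableT_comp mphi); exact: measurable_fst.
have iF : ((PXZ \x PZ)%E).-integrable setT (EFin \o F) by exact: integrable_law.
pose H (u : U * V) := phi u * frozen_mean u.1.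
have mH : measurable_fun setT H.
  apply: measurable_funM => //; apply: (measurableT_comp measurable_frozen_mean).
  exact: measurable_fst.
have mHE : measurable_fun setT (EFin \o H) by exact/measurable_EFinP.
have inner : ae_eq PXZ setT (fubini_F PZ (EFin \o F)) (EFin \o H).
  apply: filterS (ae_integrable1 iYlaw) => u iu _.
  have fin : (\int[PZ]_z (f (u.1, z))%:E)%E \is a fin_num.
    exact: (integrable_fin_num measurableT iu).
  transitivity ((phi u)%:E * \int[PZ]_z (f (u.1, z))%:E)%E.
    rewrite -(integralZl measurableT iu); apply: eq_integral => z _.
    by rewrite /F /= EFinM.
  by rewrite -(fineK fin).
have mFub := measurable_fubini_F iF.
have iH : PXZ.-integrable setT (EFin \o H).
  have /integrableP[_ FF] := integrable_fubini_F iF.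
  apply/integrableP; split=> //; apply: le_lt_trans FF.
  rewrite le_eqVlt; apply/orP; left; apply/eqP; apply: ae_eq_integral => //.
  - exact: measurableT_comp.
  - exact: measurableT_comp.
  - by apply: filterS inner => u E I0; rewrite -(E I0).
have iHP : P.-integrable setT (EFin \o (fun w => phi (X w, Z w) * frozen_mean (X w))).
  move/integrableP : iH => [_]; rewrite ge0_integral_distribution//; last first.
    exact: measurableT_comp.
  move=> fin; apply/integrableP; split=> //.
  apply/measurable_EFinP; exact: (measurableT_comp mH (measurable_funPT (rv_pair X Z))).
split=> //.
rewrite (integral_law mF iphi) -(integral12_prod_meas1 iF).
transitivity (\int[PXZ]_u (EFin \o H) u)%E; first exact: ae_eq_integral.
by rewrite (@integral_distribution _ _ _ _ _ P (rv_pair X Z) (EFin \o H)).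
Qed.

Lemma frozen_mean_cond_exp :
  is_cond_exp P (sigma_of X) Y (frozen_mean \o X).
Proof.
have mm := measurable_frozen_mean.
have split1 (phi : U -> R) : measurable_fun setT phi ->
    (forall u, `|phi u| <= 1) ->
    P.-integrable setT (EFin \o (fun w => phi (X w) * frozen_mean (X w))) /\
    (\int[P]_w (phi (X w) * Y w)%:E =
     \int[P]_w (phi (X w) * frozen_mean (X w))%:E)%E.
  move=> mphi phi1.
  have mphi' : measurable_fun setT (phi \o fst : U * V -> R).
    by apply: measurableT_comp => //; exact: measurable_fst.
  have iphiY' : P.-integrable setT (EFin \o (fun w => phi (X w) * Y' w)).
    apply: le_integrable iY' => //.
      apply/measurable_EFinP; apply: measurable_funM.
        exact: (measurableT_comp mphi).
      exact: measurable_funPT.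
    by move=> w _ /=; rewrite lee_fin normrM ler_piMl.
  have [i1 E1] := frozen_mean_integral mphi' iphiY'; split=> //.
  rewrite -E1.
  have mG : measurable_fun setT (fun u : U * V => (phi u.1 * f u)%:E).
    by apply/measurable_EFinP; exact: measurable_funM.
  exact/esym/(same_law_integral pick_freeze_law mG).
split.
- move=> _ [B mB <-]; exists (frozen_mean @^-1` B) => //.
  by rewrite -[X in measurable X]setTI; exact: mm.
- apply/Lfun1_integrable.
  have n1 (u : U) : `|cst 1 u : R| <= 1 by rewrite normr1.
  have [i1 _] := split1 (cst 1) (measurable_cst _) n1.
  apply: eq_integrable i1 => // w _.
  by rewrite /= mul1r.
- move=> _ [B mB <-]; rewrite setTI.
  have mXB : measurable (X @^-1` B) by exact: measurable_funPTI.
  have n1 (u : U) : `|\1_B u : R| <= 1.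
    by rewrite indicE; case: (u \in B); rewrite ?normr1// normr0.
  have mI : measurable_fun setT (\1_B : U -> R) by exact: measurable_indic.
  have [_ E1] := split1 (\1_B) mI n1.
  have ind (G : T -> R) : (\int[P]_w (\1_B (X w) * G w)%:E =
      \int[P]_(w in X @^-1` B) (G w)%:E)%E.
    rewrite [RHS]integral_mkcond; apply: eq_integral => w _.
    rewrite patchE indicE.
    have -> : (w \in X @^-1` B) = (X w \in B) by [].
    by case: (X w \in B); rewrite ?mul1r ?mul0r.
  by rewrite -!ind E1.
Qed.

Hypothesis Y2 : Y \in Lfun P 2%:E.

Lemma pick_freeze_Lfun2 : Y' \in Lfun P 2%:E.
Proof.
apply: integrable_sqr_Lfun2; first exact: measurable_funPT.
exact: (same_law_integrable pick_freeze_law (measurable_funX 2 mf)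
  (Lfun2_integrable_sqr Y2)).
Qed.

(** [E(Y Y') = E(Y m) = E(Y' m) = E(m ^ 2)] for the frozen mean [m]: the copy
    [Z'] is integrated out, exchanged with [Z], and integrated out again.  Square
    integrability of [m] comes as a by-product of the last Fubini step. *)
Lemma covariance_pick_freeze :
  fine (covariance P Y Y') = fine 'V_P[cond_exp P Y X]%E.
Proof.
have mm := measurable_frozen_mean.
pose m := frozen_mean \o X.
rewrite (variance_cond_exp frozen_mean_cond_exp).
have iYY' : P.-integrable setT (EFin \o (fun w => f (X w, Z w) * Y' w)).
  by apply/Lfun1_integrable; exact: Lfun2_mul_Lfun1 Y2 pick_freeze_Lfun2.
have [iYm EYm] := frozen_mean_integral mf iYY'.
have mfm : measurable_fun setT (fun u : U * V => frozen_mean u.1 * f u).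
  apply: measurable_funM => //; apply: (measurableT_comp mm).
  exact: measurable_fst.
have imY : P.-integrable setT (EFin \o (fun w => frozen_mean (X w) * f (X w, Z w))).
  by apply: eq_integrable iYm => // w _; rewrite /= mulrC.
have imY' := same_law_integrable pick_freeze_law mfm imY.
have EYm' := same_law_Rintegral pick_freeze_law mfm.
have mfst : measurable_fun setT (fun u : U * V => frozen_mean u.1).
  by apply: (measurableT_comp mm); exact: measurable_fst.
have [imm Emm] := frozen_mean_integral mfst imY'.
have m2 : m \in Lfun P 2%:E.
  apply: integrable_sqr_Lfun2; first exact: measurableT_comp.
  exact: imm.
have EY' : \int[P]_w Y' w = \int[P]_w Y w.
  exact: (same_law_Rintegral pick_freeze_law mf).
have Em : \int[P]_w m w = \int[P]_w Y w.
  have [_ _ mE] := frozen_mean_cond_exp.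
  congr fine; apply: mE; exists setT => //.
  by rewrite setTI.
rewrite (fine_covariance_centred 0 0 Y2 pick_freeze_Lfun2).
rewrite /variance (fine_covariance_centred 0 0 m2 m2).
have s0 (F : T -> R) : \int[P]_w (F w - 0) = \int[P]_w F w.
  by apply: eq_Rintegral => w _; rewrite subr0.
have p0 (F G : T -> R) : \int[P]_w ((F w - 0) * (G w - 0)) = \int[P]_w (F w * G w).
  by apply: eq_Rintegral => w _; rewrite !subr0.
rewrite !s0 !p0 EY' Em; congr (_ - _).
transitivity (\int[P]_w (f (X w, Z w) * frozen_mean (X w))); first by congr fine.
transitivity (\int[P]_w (frozen_mean (X w) * f (X w, Z w))).
  by apply: eq_Rintegral => w _; rewrite mulrC.
rewrite -EYm'; congr fine; exact: Emm.
Qed.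

End pick_freeze.

Lemma Rintegral_distribution d d' (T : measurableType d) (U : measurableType d')
    (R : realType) (P : probability T R) (X : {mfun T >-> U}) (F : U -> R) :
  measurable_fun setT F ->
  \int[distribution P X]_u F u = \int[P]_w F (X w).
Proof.
move=> mF; have mFE : measurable_fun setT (EFin \o F) by exact/measurable_EFinP.
have mP := measurable_funepos mFE; have mN := measurable_funeneg mFE.
congr fine; rewrite integralE [RHS]integralE.
rewrite (funepos_comp (EFin \o F) X) (funeneg_comp (EFin \o F) X).
by rewrite !ge0_integral_distribution.
Qed.

Lemma integrable_distribution d d' (T : measurableType d)
    (U : measurableType d') (R : realType) (P : probability T R)
    (X : {mfun T >-> U}) (F : U -> R) : measurable_fun setT F ->
  P.-integrable setT (EFin \o (F \o X)) ->
  (distribution P X).-integrable setT (EFin \o F).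
Proof.
move=> mF /integrableP[_ iF].
have mFE : measurable_fun setT (EFin \o F) by exact/measurable_EFinP.
apply/integrableP; split=> //.
by rewrite ge0_integral_distribution//; exact: measurableT_comp.
Qed.

Section output_pair.
Context d (T : measurableType d) (R : realType) (P : probability T R).
Variables A B : {mfun T >-> R}.

Let mc (F G : R * R -> R) (k l : R) : measurable_fun setT F ->
  measurable_fun setT G -> measurable_fun setT (fun x => (F x - k) * (G x - l)).
Proof. by move=> mF mG; apply: measurable_funM; exact: measurable_funB. Qed.

Lemma fine_variance_distribution :
  fine 'V_(distribution P (rv_pair A B))[fst]%E = fine 'V_P[A]%E.
Proof.
rewrite /variance !fine_covariance.
by rewrite !Rintegral_distribution//; exact: mc.
Qed.

Lemma psi_distribution : psi (distribution P (rv_pair A B)) =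
  fine (covariance P A B) / fine 'V_P[A]%E.
Proof.
rewrite /psi fine_variance_distribution !fine_covariance.
by rewrite !Rintegral_distribution//; exact: mc.
Qed.

End output_pair.

(** * Efficiency of the estimator built on the metamodel *)

Section joint_instance.
Context d (T : measurableType d).
Context d1 d2 d3 (U : measurableType d1) (V : measurableType d2)
  (E : measurableType d3).

Lemma measurable_joint (X : {mfun T >-> U}) (Z Z' : {mfun T >-> V})
    (xi xi' : {mfun T >-> E}) : measurable_fun setT (joint X Z Z' xi xi').
Proof. by do 4 apply: measurable_fun_pair => //. Qed.

HB.instance Definition _ X Z Z' xi xi' := isMeasurableFun.Build _ _ _ _
  (joint X Z Z' xi xi') (measurable_joint X Z Z' xi xi').

End joint_instance.

Lemma measurable_joint_components d1 d2 d3 (U : measurableType d1)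
    (V : measurableType d2) (E : measurableType d3) :
  [/\ measurable_fun setT (fun u : U * V * V * E * E => u.1.1.1.1),
      measurable_fun setT (fun u : U * V * V * E * E => u.1.1.1.2),
      measurable_fun setT (fun u : U * V * V * E * E => u.1.1.2) &
      measurable_fun setT (fun u : U * V * V * E * E => u.1.2)].
Proof.
have m2 : measurable_fun setT (fun u : U * V * V * E * E => u.1.1).
  exact: (measurableT_comp measurable_fst measurable_fst).
have m3 : measurable_fun setT (fun u : U * V * V * E * E => u.1.1.1).
  exact: (measurableT_comp measurable_fst m2).
split.
- exact: (measurableT_comp measurable_fst m3).
- exact: (measurableT_comp measurable_snd m3).
- exact: (measurableT_comp measurable_snd m2).
- exact: (measurableT_comp measurable_snd measurable_fst).
Qed.

Section fourth_moment.
Context d (T : measurableType d) (R : realType) (P : probability T R).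

(** The fourth power is at most 1 plus any higher power. *)
Lemma sqr_centred_Lfun2 (F : T -> R) (s C m : R) : measurable_fun setT F ->
  0 < s -> ('E_P[(fun w => `|F w| `^ (4 + s))%R] < C%:E)%E ->
  (fun w => (F w - m) ^+ 2) \in Lfun P 2%:E.
Proof.
move=> mF s0 EC.
have mpow : measurable_fun setT (fun w => `|F w| `^ (4 + s)).
  by apply: (measurableT_comp (measurable_powR _)); exact: measurableT_comp.
have ipow : P.-integrable setT (EFin \o (fun w => `|F w| `^ (4 + s))).
  apply/integrableP; split; first exact/measurable_EFinP.
  move: EC; rewrite unlock => EC; apply: le_lt_trans (lt_trans EC (ltry C)).
  apply: ge0_le_integral => //=.
  - by apply/measurable_EFinP; exact: measurableT_comp.
  - exact/measurable_EFinP.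
  - by move=> w _; rewrite lee_fin ger0_norm// powR_ge0.
have i1 : P.-integrable setT (EFin \o (cst (8 * (1 + m ^+ 4)) : T -> R)).
  exact: finite_measure_integrable_cst.
have ibound := integrableD measurableT (integrableZl measurableT 8 ipow) i1.
have mB : measurable_fun setT (fun w => F w - m) by exact: measurable_funB.
apply: integrable_sqr_Lfun2; first exact: measurable_funX.
apply: le_integrable ibound => //.
  by apply/measurable_EFinP; do 2 apply: measurable_funX.
move=> w _ /=; rewrite lee_fin ger0_norm ?sqr_ge0//.
apply: le_trans (ler_norm _).
set y := F w.
have y4 : (y ^+ 2) ^+ 2 <= 1 + `|y| `^ (4 + s).
  have -> : (y ^+ 2) ^+ 2 = `|y| ^+ 4.
    by rewrite -(real_normK (num_real y)) -exprM.
  have [y1|y1] := leP `|y| 1.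
    by rewrite (le_trans (exprn_ile1 _ _ _))// lerDl powR_ge0.
  rewrite -powR_mulrn//; apply: (@le_trans _ _ (`|y| `^ (4 + s))).
    by rewrite ler_powR ?ltW// ltrDl.
  by rewrite lerDr.
have h : ((y - m) ^+ 2) ^+ 2 <= 8 * ((y ^+ 2) ^+ 2) + 8 * m ^+ 4.
  have h1 : (y - m) ^+ 2 <= 2 * (y ^+ 2 + m ^+ 2).
    by have := sqr_ge0 (y + m); lra.
  have h2 : ((y - m) ^+ 2) ^+ 2 <= (2 * (y ^+ 2 + m ^+ 2)) ^+ 2.
    apply: lerXn2r => //; rewrite nnegrE; first exact: sqr_ge0.
    by apply: mulr_ge0 => //; apply: addr_ge0; exact: sqr_ge0.
  by apply: (le_trans h2); have := sqr_ge0 (y ^+ 2 - m ^+ 2); lra.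
by apply: (le_trans h); lra.
Qed.

End fourth_moment.

Section perturbation_size.
Context d (T : measurableType d) (R : realType) (P : probability T R).

(** [N E(D ^ 2) = N Var D + (sqrt N E D) ^ 2] *)
Lemma scaled_second_moment_cvg0 (D : nat -> T -> R) :
  (forall N, (0 < N)%N -> D N \in Lfun P 2%:E) ->
  (N%:R%:E * 'V_P[D N])%E @[N --> \oo] --> 0%E ->
  ((Num.sqrt (N%:R : R))%:E * 'E_P[D N])%E @[N --> \oo] --> 0%E ->
  N%:R * \int[P]_w (D N w ^+ 2) @[N --> \oo] --> (0 : R).
Proof.
move=> D2 /fine_cvg hV /fine_cvg hE.
have lim : fine (N%:R%:E * 'V_P[D N])%E +
    fine ((Num.sqrt (N%:R : R))%:E * 'E_P[D N])%E ^+ 2 @[N --> \oo] --> (0 : R).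
  have -> : 0 = 0 + 0 * 0 :> R by rewrite mulr0 addr0.
  by apply: cvgD; [exact: hV|apply: cvgM; exact: hE].
apply: cvg_trans lim; apply: near_eq_cvg; near=> N.
have N0 : (0 < N)%N by near: N; exact: nbhs_infty_gt.
have DN := D2 N N0; have DN1 := Lfun2_Lfun1 DN.
rewrite fineM//; last exact: variance_fin_num.
rewrite fineM//; last exact: expectation_fin_num.
rewrite /= /variance (fine_covariance_centred 0 0 DN DN) fine_expectation.
rewrite exprMn sqr_sqrtr// -mulrDr; congr (_ * _).
have s0 : \int[P]_w (D N w - 0) = \int[P]_w D N w.
  by apply: eq_Rintegral => w _; rewrite subr0.
rewrite s0 expr2 subrK.
by apply: eq_Rintegral => w _; rewrite subr0.
Unshelve. all: by end_near. Qed.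

End perturbation_size.

Theorem proposition3p6 (R : realType)
  (d : measure_display) (T : measurableType d) (P : probability T R)
  (p1 p2 : nat) (dE : measure_display) (E : measurableType dE)
  (f : {mfun (p1.-tuple R * p2.-tuple R)%type >-> R})
  (X : {RV P >-> p1.-tuple R}) (Z Z' : {RV P >-> p2.-tuple R})
  (xi xi' : {RV P >-> E})
  (delta : nat -> {mfun (p1.-tuple R * p2.-tuple R * E)%type >-> R})
  (Xs : nat -> {RV P >-> p1.-tuple R}) (Zs Zs' : nat -> {RV P >-> p2.-tuple R})
  (xis xis' : nat -> {RV P >-> E})
  (v0 : R)
  (* the population *)
  (hindep : mutually_independent P
     (tnth [tuple sigma_of X; sigma_of Z; sigma_of Z';
                  sigma_of xi; sigma_of xi']))
  (hZ' : same_law P Z' Z) (hxi' : same_law P xi' xi)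
  (hY2 : output f X Z \in Lfun P 2%:E)
  (hVarY : ('V_P[output f X Z] != 0)%E)
  (* the metamodel *)
  (hdelta2 : forall N, (0 < N)%N ->
     perturbation (delta N) X Z xi \in Lfun P 2%:E)
  (hdeltaX2 : forall N, (0 < N)%N ->
     perturbation (delta N) X Z' xi' \in Lfun P 2%:E)
  (hVarYN : forall N, (0 < N)%N ->
     ('V_P[meta_output f (delta N) X Z xi] != 0)%E)
  (hdelta : exists c : R,
     ('N[P]_2%:E[EFin \o (perturbation (delta N) X Z xi \- cst c)%R])%E
       @[N --> \oo] --> 0%E)
  (* the i.i.d. sample *)
  (hsample_indep : mutually_independent P (fun i : nat =>
     sigma_of (joint (Xs i) (Zs i) (Zs' i) (xis i) (xis' i))))
  (hsample_law : forall i, same_law P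
     (joint (Xs i) (Zs i) (Zs' i) (xis i) (xis' i)) (joint X Z Z' xi xi'))
  (* the assumptions of the proposition *)
  (hmoments : exists s C : R, [/\ 0 < s, 0 < C & forall N, (0 < N)%N ->
     ('E_P[(fun w => `|output f X Z w| `^ (4 + s))%R] < C%:E)%E /\
     ('E_P[(fun w => `|meta_output f (delta N) X Z xi w| `^ (4 + s))%R] < C%:E)%E])
  (hvar : (N%:R%:E * 'V_P[perturbation (delta N) X Z xi])%E
     @[N --> \oo] --> 0%E)
  (hmean : ((Num.sqrt (N%:R : R))%:E * 'E_P[perturbation (delta N) X Z xi])%E
     @[N --> \oo] --> 0%E) :
  let Q := distribution P (rv_pair (output f X Z) (output f X Z')) in
  psi Q = sobol_index P X (output f X Z) /\
  asymptotically_efficient P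
    (fun i => rv_pair (output f (Xs i) (Zs i)) (output f (Xs i) (Zs' i)))
    (fun N w => sobol_estimator v0 N
       (fun i => meta_output f (delta N) (Xs i) (Zs i) (xis i) w)
       (fun i => meta_output f (delta N) (Xs i) (Zs' i) (xis' i) w))
    Q.
Proof.
move=> Q; set Y := output f X Z; set Y' := output f X Z'.
pose var i : (i < 5)%N -> 'I_5 := @Ordinal 5 i.
have indepZ := mutually_independent3_preimage (X := X) (Y := Z) (Z := Z')
  (i := var 0%N isT) (j := var 1%N isT) (k := var 2%N isT)
  hindep isT (@subset_refl _ _) (@subset_refl _ _) (@subset_refl _ _).
have indepxi := mutually_independent3_preimage (X := X) (Y := Z) (Z := xi)
  (i := var 0%N isT) (j := var 1%N isT) (k := var 3%N isT)
  hindep isT (@subset_refl _ _) (@subset_refl _ _) (@subset_refl _ _).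
have indepxi' := mutually_independent3_preimage (X := X) (Y := Z') (Z := xi')
  (i := var 0%N isT) (j := var 2%N isT) (k := var 4%N isT)
  hindep isT (@subset_refl _ _) (@subset_refl _ _) (@subset_refl _ _).
have law' : same_law P (rv_pair (rv_pair X Z') xi') (rv_pair (rv_pair X Z) xi).
  exact: independent_triple_same_law.
have Y1 := Lfun2_Lfun1 hY2.
have psiE : psi Q = sobol_index P X Y.
  rewrite /Q psi_distribution /sobol_index.
  by rewrite (covariance_pick_freeze indepZ hZ' Y1 hY2).
split=> //.
(* the moment of Y does not depend on N; N = 1 is an admissible index *)
have [s [C [s0 _ /(_ 1%N isT)[EY4 _]]]] := hmoments.
have mY : measurable_fun setT Y by exact: measurable_funPT.
have Y4 m := sqr_centred_Lfun2 m mY s0 EY4.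
pose mu := \int[Q]_x x.1.
have Qsym := exchangeable_outputs f indepZ hZ'.
have mx1 k : measurable_fun setT (fun x : R * R => (x.1 - k) ^+ 2).
  by apply: measurable_funX; exact: measurable_funB.
have Q4 : (fun x : R * R => (x.1 - mu) ^+ 2) \in Lfun Q 2%:E.
  apply: integrable_sqr_Lfun2 => //.
  apply: integrable_distribution; first exact: measurable_funX.
  exact: Lfun2_integrable_sqr (Y4 mu).
have VN0 : fine 'V_P[Y]%E != 0 by rewrite fine_eq0// variance_fin_num.
have Qv : ('V_Q[fst] != 0)%E.
  apply/eqP => V0; move: VN0.
  by rewrite -(fine_variance_distribution P Y Y') -/Q V0 eqxx.
have QM := exchangeable_in_model Qsym Q4.
split=> //; exists (sobol_influence Q).
  exact: sobol_influence_efficient.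
pose a (u : p1.-tuple R * p2.-tuple R * p2.-tuple R * E * E) :=
  f (u.1.1.1.1, u.1.1.1.2) - mu.
pose b (u : p1.-tuple R * p2.-tuple R * p2.-tuple R * E * E) :=
  f (u.1.1.1.1, u.1.1.2) - mu.
pose p N (u : p1.-tuple R * p2.-tuple R * p2.-tuple R * E * E) :=
  delta N (u.1.1.1.1, u.1.1.1.2, u.1.2).
pose q N (u : p1.-tuple R * p2.-tuple R * p2.-tuple R * E * E) :=
  delta N (u.1.1.1.1, u.1.1.2, u.2).
have [mX mZ mZ' mxi] :=
  measurable_joint_components (p1.-tuple R) (p2.-tuple R) E.
have ma : measurable_fun setT a.
  apply: measurable_funB => //; apply: measurableT_comp => //.
  exact: measurable_fun_pair.
have mb : measurable_fun setT b.
  apply: measurable_funB => //; apply: measurableT_comp => //.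
  exact: measurable_fun_pair.
have mp N : measurable_fun setT (p N).
  apply: measurableT_comp => //; apply: measurable_fun_pair => //.
  exact: measurable_fun_pair.
have mq N : measurable_fun setT (q N).
  apply: measurableT_comp => //.
  apply: measurable_fun_pair; last exact: measurable_snd.
  exact: measurable_fun_pair.
have Lp N : (0 < N)%N -> (fun w => p N (joint X Z Z' xi xi' w)) \in Lfun P 2%:E.
  exact: hdelta2.
have Lq N : (0 < N)%N -> (fun w => q N (joint X Z Z' xi xi' w)) \in Lfun P 2%:E.
  exact: hdeltaX2.
have Np := scaled_second_moment_cvg0 hdelta2 hvar hmean.
have Nq : N%:R * \int[P]_w (q N (joint X Z Z' xi xi' w) ^+ 2) @[N --> \oo] --> (0 : R).
  have E1 N : \int[P]_w (q N (joint X Z Z' xi xi' w) ^+ 2) =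
      \int[P]_w (perturbation (delta N) X Z xi w ^+ 2).
    apply: (same_law_Rintegral (F := fun u => delta N u ^+ 2) law').
    exact: measurable_funX.
  by under eq_fun do rewrite E1; exact: Np.
have mf : measurable_fun setT (fun u : p1.-tuple R * p2.-tuple R => (f u - mu) ^+ 2).
  by apply: measurable_funX; exact: measurable_funB.
have b4 : (fun w => b (joint X Z Z' xi xi' w) ^+ 2) \in Lfun P 2%:E.
  apply: integrable_sqr_Lfun2.
    apply: measurable_funX; exact: (measurableT_comp mb (measurable_funPT _)).
  exact: (same_law_integrable (pick_freeze_law indepZ hZ')
    (measurable_funX 2 mf) (Lfun2_integrable_sqr (Y4 mu))).
have lawQ (F : R * R -> R) : measurable_fun setT F ->
    \int[P]_w F (Y w, Y' w) = \int[Q]_x F x.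
  by move=> mF; rewrite Rintegral_distribution.
have mx : measurable_fun setT (fun x : R * R => x.1 - mu) by exact: measurable_funB.
have my : measurable_fun setT (fun x : R * R => x.2 - mu) by exact: measurable_funB.
have a0 : \int[P]_w a (joint X Z Z' xi xi' w) = 0.
  by rewrite -(fst_centred Q4); exact: (lawQ (fun x => x.1 - mu)).
have b0 : \int[P]_w b (joint X Z Z' xi xi' w) = 0.
  by rewrite -(snd_centred Qsym Q4); exact: (lawQ (fun x => x.2 - mu)).
have ab : \int[P]_w (a (joint X Z Z' xi xi' w) * b (joint X Z Z' xi xi' w)) =
    psi Q * fine 'V_Q[fst]%E.
  rewrite -(psi_covariance Qsym Q4 Qv).
  apply: (lawQ (fun x => (x.1 - mu) * (x.2 - mu))).
  exact: measurable_funM.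
have a2b2 : \int[P]_w ((a (joint X Z Z' xi xi' w) ^+ 2 +
    b (joint X Z Z' xi xi' w) ^+ 2) / 2) = fine 'V_Q[fst]%E.
  rewrite -(half_sum_squares Qsym Q4).
  apply: (lawQ (fun x => ((x.1 - mu) ^+ 2 + (x.2 - mu) ^+ 2) / 2)).
  by apply: measurable_funM => //; apply: measurable_funD; exact: measurable_funX.
have lin := @sobol_estimator_linear _ _ _ _ _ _
  (fun i => joint (Xs i) (Zs i) (Zs' i) (xis i) (xis' i)) (joint X Z Z' xi xi')
  hsample_indep hsample_law v0 mu _ _ a b p q ma mb mp mq (Y4 mu) b4 Lp Lq
  a0 b0 ab a2b2 (variance_fst_gt0 Q4 Qv) Np Nq.
apply: eq_cvg_proba lin => N w.
have estE : sobol_estimator v0 N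
    (fun i => mu + a (joint (Xs i) (Zs i) (Zs' i) (xis i) (xis' i) w) +
      p N (joint (Xs i) (Zs i) (Zs' i) (xis i) (xis' i) w))
    (fun i => mu + b (joint (Xs i) (Zs i) (Zs' i) (xis i) (xis' i) w) +
      q N (joint (Xs i) (Zs i) (Zs' i) (xis i) (xis' i) w)) =
    sobol_estimator v0 N
      (fun i => meta_output f (delta N) (Xs i) (Zs i) (xis i) w)
      (fun i => meta_output f (delta N) (Xs i) (Zs' i) (xis' i) w).
  congr (sobol_estimator _ _ _ _); apply/funext => i.
    by rewrite /a subrKC.
  by rewrite /b subrKC.
by rewrite estE.
Qed.
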